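(* Let $s\in\{1,-1\}$, $\alpha\ge 0$ and $f\in L^2(\Omega)$. If $u\in V_\alpha(\Omega)$ satisfies $$\int_\Omega \nabla u\cdot\nabla\overline{v}+u\overline{v}\,dxdy+s\int_{\Gamma_+}x^\alpha\,\partial_xu\,\partial_x\overline{v}\,dx=\int_\Omega f\overline{v}\,dxdy\qquad\text{for all }v\in V_\alpha(\Omega),$$ then $u$ solves $$-\Delta u+u=f\ \text{ in }\Omega,\qquad \partial_\nu u=0\ \text{ on }\partial\Omega\setminus\overline{\Gamma_+},\qquad \partial_\nu u=s\,\partial_x(x^\alpha\,\partial_xu)\ \text{ on }\Gamma_+,$$ where the last condition holds in $\mathcal{D}'(\Gamma_+)$, i.e. in the sense of distributions on $\Gamma_+$.
   Context: $\Omega\subset\mathbb{R}^2$ is an open, connected, bounded set with Lipschitz continuous boundary $\partial\Omega$ such that $\Gamma:=(-1,1)\times\{0\}\subset\partial\Omega$. Set $\Gamma_+:=(0,1)\times\{0\}$, identified with $(0,1)$, and let $\nu$ be the outward unit normal vector to $\partial\Omega$. Functions are complex-valued. For $v\in H^1(\Omega)$, boundary values are taken in the trace sense, and $\partial_xv$ on $\Gamma_+$ is the distributional derivative along $\Gamma_+$ of the trace $v|_{\Gamma_+}$. Define $$V_\alpha(\Omega):=\{v\in H^1(\Omega)\,|\,x^{\alpha/2}\partial_xv\in L^2(\Gamma_+)\}.$$ The equation in $\Omega$ is understood in $\mathcal{D}'(\Omega)$. For $u\in H^1(\Omega)$ with $\Delta u\in L^2(\Omega)$, $\partial_\nu u\in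 H^{-1/2}(\partial\Omega)$ is defined by the Green formula $\langle\partial_\nu u,\overline{v}\rangle=\int_\Omega\nabla u\cdot\nabla\overline{v}+\Delta u\,\overline{v}\,dxdy$ for all $v\in H^1(\Omega)$. The condition $\partial_\nu u=0$ on $\partial\Omega\setminus\overline{\Gamma_+}$ means $\langle\partial_\nu u,\overline{\phi}\rangle=0$ for all $\phi\in H^{1/2}(\partial\Omega)$ that vanish on $\Gamma_+$. *)

(* Defs.v *)
From HB Require Import structures.
From mathcomp Require Import all_boot all_order all_algebra.
From mathcomp Require Import all_classical all_reals all_analysis.
From mathcomp Require Import complex.
From mathcomp Require Import measurable_realfun.
Import Order.TTheory GRing.Theory Num.Theory numFieldNormedType.Exports.
Set Implicit Arguments.
Unset Strict Implicit.
Unset Printing Implicit Defensive.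
Local Open Scope classical_set_scope.
Local Open Scope ring_scope.

Section hausdorff.
Context {R : realType}.
Local Notation plane := (measurableTypeR R * measurableTypeR R)%type.
Implicit Types (A B X Y Z : set (R * R)) (F : (set (R * R))^nat) (delta : R).
Local Open Scope ereal_scope.

Definition dist2 (p q : R * R) : R :=
  Num.sqrt ((p.1 - q.1) ^+ 2 + (p.2 - q.2) ^+ 2)%R.

(* [0] is added so that [diam set0] is [0] and not [-oo] *)
Definition diam A : \bar R :=
  ereal_sup [set x | x = 0 \/
    exists p q : R * R, [/\ A p, A q & x = (dist2 p q)%:E]].

(* The one-dimensional Hausdorff measure of the Euclidean plane *)
Definition hausdorff1_pre delta A : \bar R :=
  ereal_inf [set \sum_(i <oo) diam (F i) | F in
    [set F | A `<=` \bigcup_i F i /\ forall i, diam (F i) <= delta%:E]].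

Definition hausdorff1 A : \bar R :=
  ereal_sup [set hausdorff1_pre delta A | delta in [set d | (0 < d)%R]].

Lemma diam_ge0 A : 0 <= diam A.
Proof. by apply: ereal_sup_ubound; left. Qed.

Lemma diam0 : diam set0 = 0.
Proof.
apply/eqP; rewrite eq_le diam_ge0 andbT; apply: ge_ereal_sup.
by move=> x /= [->//|[p [q []]]].
Qed.

Lemma dist2_le_diam A p q : A p -> A q -> (dist2 p q)%:E <= diam A.
Proof. by move=> Ap Aq; apply: ereal_sup_ubound; right; exists p, q. Qed.

Lemma sum_diam_ge0 F : 0 <= \sum_(i <oo) diam (F i).
Proof. by apply: nneseries_ge0 => i _ _; exact: diam_ge0. Qed.

Lemma hausdorff1_pre_ge0 delta A : 0 <= hausdorff1_pre delta A.
Proof. by apply: le_ereal_inf_tmp => x /= [F _ <-]; exact: sum_diam_ge0. Qed.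

Lemma hausdorff1_pre0 delta : (0 < delta)%R -> hausdorff1_pre delta set0 = 0.
Proof.
move=> d0; apply/eqP; rewrite eq_le hausdorff1_pre_ge0 andbT.
apply: ereal_inf_lbound; exists (fun=> set0); last first.
  by rewrite eseries0// => i _ _; exact: diam0.
by split=> // i; rewrite diam0 lee_fin ltW.
Qed.

Lemma le_hausdorff1_pre delta : {homo hausdorff1_pre delta : A B / A `<=` B >-> A <= B}.
Proof.
move=> A B AB; apply: ereal_inf_le_tmp => x /= [F [BF dF] <-].
by exists F => //; split => //; exact: subset_trans BF.
Qed.

Lemma hausdorff1_pre_nincr d e A : (d <= e)%R ->
  hausdorff1_pre e A <= hausdorff1_pre d A.
Proof.
move=> de; apply: ereal_inf_le_tmp => x /= [F [AF dF] <-].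
exists F => //; split => // i; rewrite (le_trans (dF i))// lee_fin//.
Qed.

Lemma hausdorff1_pre_sigma_subadditive delta :
  sigma_subadditive (hausdorff1_pre delta).
Proof.
move=> A.
have [[i ioo]|] := pselect (exists i, hausdorff1_pre delta (A i) = +oo).
  rewrite (eseries_pinfty _ _ ioo) ?leey// => n _.
  by rewrite -ltNye (lt_le_trans _ (hausdorff1_pre_ge0 _ _)).
rewrite -forallNE => Aoo.
apply/lee_addgt0Pr => e e0.
rewrite (le_trans _ (epsilon_trick _ _ (ltW e0)))//; last first.
  by move=> n; exact: hausdorff1_pre_ge0.
pose P n (B : (set (R * R))^nat) :=
  [/\ A n `<=` \bigcup_i B i, (forall i, diam (B i) <= delta%:E) &
  \sum_(k <oo) diam (B k) <=
    hausdorff1_pre delta (A n) + (e / (2 ^ n.+1)%:R)%:E].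
have [G PG] : {G : ((set (R * R))^nat)^nat & forall n, P n (G n)}.
  apply: (@choice _ _ P) => n.
  have en1 : (0 < e / (2 ^ n.+1)%:R)%R by rewrite divr_gt0// ltr0n expn_gt0.
  have /(lb_ereal_inf_adherent en1) : hausdorff1_pre delta (A n) \is a fin_num.
    rewrite ge0_fin_numE ?hausdorff1_pre_ge0// ltey; exact/eqP/Aoo.
  move=> [x [B [AnB dB] <-] xS].
  by exists B; split => //; exact/ltW.
have G_ge0 x : 0 <= (diam \o uncurry G) x by exact: diam_ge0.
apply: (@le_trans _ _ (\esum_(i in setT) (diam \o uncurry G) i)).
  apply: ereal_inf_lbound => /=.
  have /card_esym/ppcard_eqP[f] := card_nat2.
  exists (uncurry G \o f).
    split => [t [i _ Ait]|i]; last first.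
      have [_ /(_ (f i).2) + _] := PG (f i).1.
      by rewrite /=; case: (f i).
    have [/(_ _ Ait)[j _ Bijt] _ _] := PG i; exists (f^-1%FUN (i, j)) => //=.
    by rewrite invK ?inE.
  rewrite -(esum_pred_image (diam \o uncurry G) _ xpredT) ?[fun=> _]set_true//.
  by rewrite image_eq.
rewrite (_ : esum _ _ = \sum_(i <oo) \sum_(j <oo ) diam (G i j)); last first.
  pose J : nat -> set (nat * nat) := fun i => [set (i, j) | j in setT].
  rewrite (_ : setT = \bigcup_k J k); last first.
    by rewrite predeqE => -[a b]; split => // _; exists a => //; exists b.
  rewrite esum_bigcupT /=; last 2 first.
    - apply/trivIsetP => i j _ _ ij.
      rewrite predeqE => -[n m] /=; split => //= -[] [_] _ [<-{n} _].
      by move=> [m' _] [] /esym/eqP; rewrite (negbTE ij).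
    - by move=> /= [n m]; exact: diam_ge0.
  rewrite -(image_id [set: nat]) -fun_true esum_pred_image//; last first.
    by move=> n _; apply: esum_ge0 => p _; exact: diam_ge0.
  apply: eq_eseriesr => /= j _.
  rewrite -(esum_pred_image (diam \o uncurry G) (pair j) predT)//=; [|by move=> n _; exact: diam_ge0|
    by move=> ? ? _ _; exact: (@can_inj _ _ _ snd)].
  by congr esum; rewrite predeqE => -[a b]; split; move=> [i _ <-]; exists i.
apply: lee_nneseries => [i *|i *]; first exact: sum_diam_ge0.
by have [] := PG i.
Qed.

Lemma hausdorff1_pre_le delta A : (0 < delta)%R ->
  hausdorff1_pre delta A <= hausdorff1 A.
Proof. by move=> d0; apply: ereal_sup_ubound; exists delta. Qed.

Lemma hausdorff1_ge0 A : 0 <= hausdorff1 A.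
Proof. exact: le_trans (hausdorff1_pre_ge0 1 A) (hausdorff1_pre_le A ltr01). Qed.

Lemma hausdorff1_0 : hausdorff1 set0 = 0.
Proof.
apply/eqP; rewrite eq_le hausdorff1_ge0 andbT; apply: ge_ereal_sup.
by move=> x /= [d d0 <-]; rewrite hausdorff1_pre0.
Qed.

Lemma le_hausdorff1 : {homo hausdorff1 : A B / A `<=` B >-> A <= B}.
Proof.
move=> A B AB; apply: ge_ereal_sup => x /= [d d0 <-].
by rewrite (le_trans (le_hausdorff1_pre d AB))// hausdorff1_pre_le.
Qed.

Lemma hausdorff1_sigma_subadditive : sigma_subadditive hausdorff1.
Proof.
move=> F; apply: ge_ereal_sup => x /= [d d0 <-].
rewrite (le_trans (hausdorff1_pre_sigma_subadditive d F))//.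
apply: lee_nneseries => [i *|i *]; first exact: hausdorff1_pre_ge0.
exact: hausdorff1_pre_le.
Qed.

HB.instance Definition _ := isOuterMeasure.Build R (R * R)%type hausdorff1
  hausdorff1_0 hausdorff1_ge0 le_hausdorff1 hausdorff1_sigma_subadditive.

Lemma hausdorff1_pre_separated delta Y Z :
  (forall y z, Y y -> Z z -> (delta < dist2 y z)%R) ->
  hausdorff1_pre delta Y + hausdorff1_pre delta Z <=
  hausdorff1_pre delta (Y `|` Z).
Proof.
move=> YZ; apply: le_ereal_inf_tmp => _ /= [F [YZF dF] <-].
pose G W i := if pselect (F i `&` W !=set0) then F i else set0.
have G_ge0 W i : 0 <= diam (G W i) by exact: diam_ge0.
have GW W : W `<=` Y `|` Z ->
    hausdorff1_pre delta W <= \sum_(i <oo) diam (G W i).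
  move=> WYZ; apply: ereal_inf_lbound; exists (G W) => //; split.
    move=> p Wp; have [i _ Fip] := YZF _ (WYZ _ Wp); exists i => //.
    by rewrite /G; case: pselect => //= FW; exfalso; apply: FW; exists p.
  move=> i; rewrite /G; case: pselect => FW /=; first exact: dF.
  by rewrite diam0 (le_trans _ (dF i))// diam_ge0.
apply: (le_trans (leeD (GW Y _) (GW Z _))).
- by move=> p; left.
- by move=> p; right.
rewrite -nneseriesD//; apply: lee_nneseries => [i *|i *]; first by rewrite adde_ge0.
rewrite /G; case: pselect => [FY|FY]; case: pselect => [FZ|FZ] /=;
  rewrite ?diam0 ?adde0 ?add0e ?diam_ge0//.
have [[y [Fy Yy]] [z [Fz Zz]]] := (FY, FZ).
have := le_trans (dist2_le_diam Fy Fz) (dF i).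
by rewrite lee_fin leNgt YZ.
Qed.

Lemma hausdorff1_separated e Y Z : (0 < e)%R ->
  (forall y z, Y y -> Z z -> (e <= dist2 y z)%R) ->
  hausdorff1 Y + hausdorff1 Z <= hausdorff1 (Y `|` Z).
Proof.
move=> e0 YZ; have [->|] := eqVneq (hausdorff1 (Y `|` Z)) +oo; first exact: leey.
rewrite -ltey => Moo.
have fin W : W `<=` Y `|` Z -> hausdorff1 W \is a fin_num.
  move=> WYZ; rewrite ge0_fin_numE ?hausdorff1_ge0//.
  exact: le_lt_trans (le_hausdorff1 WYZ) Moo.
have fY := fin _ (@subsetUl _ Y Z); have fZ := fin _ (@subsetUr _ Y Z).
rewrite -leeBrDr//; apply: ge_ereal_sup => _ /= [d d0 <-].
have fd : hausdorff1_pre d Y \is a fin_num.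
  rewrite ge0_fin_numE ?hausdorff1_pre_ge0//.
  by rewrite (le_lt_trans (hausdorff1_pre_le _ d0))// -ge0_fin_numE ?hausdorff1_ge0.
rewrite leeBrDr// addeC -leeBrDr//; apply: ge_ereal_sup => _ /= [d' d'0 <-].
rewrite leeBrDr// addeC.
pose m := Num.min (Num.min d d') (e / 2)%R.
have m0 : (0 < m)%R by rewrite !lt_min d0 d'0 divr_gt0.
have md : (m <= d)%R by rewrite /m !ge_min lexx.
have md' : (m <= d')%R by rewrite /m !ge_min lexx orbT.
have me : (m < e)%R.
  by rewrite /m !gt_min (_ : e / 2 < e)%R ?orbT// ltr_pdivrMr// ltr_pMr// ltr1n.
apply: le_trans (hausdorff1_pre_le (Y `|` Z) m0).
apply: le_trans (hausdorff1_pre_separated _); last first.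
  by move=> y z Yy Zz; exact: lt_le_trans (YZ _ _ Yy Zz).
by apply: leeD; exact: hausdorff1_pre_nincr.
Qed.

Section halfplane.
Variable g : R * R -> R.
Hypothesis g_le : forall p q, (`|g p - g q| <= dist2 p q)%R.

Let separated Y Z (a b : R) : (a < b)%R ->
  Y `<=` [set p | (b <= g p)%R] -> Z `<=` [set p | (g p <= a)%R] ->
  hausdorff1 Y + hausdorff1 Z <= hausdorff1 (Y `|` Z).
Proof.
move=> ab Yb Za; apply: (@hausdorff1_separated (b - a)%R); first by rewrite subr_gt0.
move=> y z /Yb /= yb /Za /= za; apply: le_trans (g_le y z).
by apply: le_trans (ler_norm _); rewrite lerB.
Qed.

Variables (x : R) (X : set (R * R)).
Hypothesis Xoo : hausdorff1 X < +oo.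

Let v n : R := (x + n.+1%:R^-1)%R.
Let P n := X `&` [set p | (v n.+1 < g p <= v n)%R].

Let v_decr m n : (m < n)%N -> (v n < v m)%R.
Proof. by move=> mn; rewrite /v ltrD2l ltf_pV2 ?posrE// ltr_nat ltnS. Qed.

Let pieces b m : \sum_(k < m) hausdorff1 (P (k.*2 + b)%N) <= hausdorff1 X.
Proof.
suff H : \sum_(k < m) hausdorff1 (P (k.*2 + b)%N) <=
    hausdorff1 (\big[setU/set0]_(k < m) P (k.*2 + b)%N).
  apply: (le_trans H); apply: le_hausdorff1.
  rewrite -(bigcup_mkord _ (fun k => P (k.*2 + b)%N)).
  by apply: bigcup_sub => k _ p [].
elim: m => [|m IH]; first by rewrite !big_ord0 hausdorff1_0.
rewrite !big_ord_recr/=; apply: (le_trans (leeD2r _ IH)).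
case: m {IH} => [|m]; first by rewrite !big_ord0 hausdorff1_0 add0e set0U.
apply: (@separated _ _ (v (m.+1.*2 + b)) (v (m.*2.+1 + b))).
- by apply: v_decr; rewrite doubleS !addSn.
- rewrite -(bigcup_mkord _ (fun k => P (k.*2 + b)%N)).
  move=> p [k /= km [_ /= /andP[+ _]]] => /ltW; apply: le_trans.
  have [->|km'] := eqVneq k m; first by rewrite addSn.
  apply/ltW/v_decr; rewrite -addSn ltn_add2r ltnS ltn_double.
  by rewrite ltn_neqAle km' -ltnS.
- by move=> p [_ /= /andP[]].
Qed.

Let pieces_lty : \sum_(k <oo) hausdorff1 (P k) < +oo.
Proof.
apply: (@le_lt_trans _ _ (hausdorff1 X + hausdorff1 X)); last exact: lte_add_pinfty.
apply: lime_le; first by apply: is_cvg_nneseries => n _ _; exact: hausdorff1_ge0.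
apply: nearW => n /=; rewrite big_mkord.
apply: (@le_trans _ _ (\sum_(k < n.*2) hausdorff1 (P k))).
  rewrite -!(big_mkord xpredT (hausdorff1 \o P)).
  apply: lee_sum_nneg_natr => [k _ _|]; first exact: hausdorff1_ge0.
  by rewrite -addnn leq_addr.
apply: le_trans (leeD (pieces 0 n) (pieces 1 n)).
rewrite -big_split/=; elim: n => [|n IH]; first by rewrite !big_ord0.
rewrite doubleS !big_ord_recr/= -addeA addn0 addn1.
exact: leeD.
Qed.

Lemma hausdorff1_halfplane_le :
  hausdorff1 (X `&` [set p | (x < g p)%R]) +
  hausdorff1 (X `&` ~` [set p | (x < g p)%R]) <= hausdorff1 X.
Proof.
have Xfin : hausdorff1 X \is a fin_num by rewrite ge0_fin_numE ?hausdorff1_ge0.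
have tail0 : \sum_(n <= k <oo) hausdorff1 (P k) @[n --> \oo] --> 0.
  apply: nneseries_tail_cvg => //.
  by move=> k _; exact: hausdorff1_ge0.
suff main n : hausdorff1 (X `&` [set p | (x < g p)%R]) +
    hausdorff1 (X `&` ~` [set p | (x < g p)%R]) <=
    hausdorff1 X + \sum_(n <= k <oo) hausdorff1 (P k).
  have /cvg_lim : hausdorff1 X + \sum_(n <= k <oo) hausdorff1 (P k) @[n --> \oo]
      --> hausdorff1 X + 0 by apply: cvgeD => //; [exact: fin_num_adde_defl|exact: cvg_cst].
  rewrite adde0 => <-//; apply: lime_ge; last exact: nearW.
  apply/cvg_ex; exists (hausdorff1 X + 0).
  by apply: cvgeD => //; [exact: fin_num_adde_defl|exact: cvg_cst].
have dec : X `&` [set p | (x < g p)%R] `<=`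
    (X `&` [set p | (v n < g p)%R]) `|` \bigcup_(k in ~` `I_n) P k.
  move=> p [Xp /= xp]; have [vp|vp] := ltP (v n) (g p); first by left.
  right.
  have ex : exists k, (v k < g p)%R.
    have := @ltr_add_invr R x (g p) xp => -[k ?]; exists k; exact.
  have := ex_minnP ex => -[[|k] vk kmin].
    have := lt_le_trans vk vp; case: (n) => [|j]; first by rewrite ltxx.
    by rewrite ltNge ltW// v_decr.
  have gk : (g p <= v k)%R.
    by rewrite leNgt; apply/negP => /kmin; rewrite ltnn.
  exists k; last by split => //=; rewrite vk.
  move=> /= kn; have := lt_le_trans vk vp; rewrite ltNge.
  by move: kn; rewrite leq_eqVlt => /orP[/eqP <-|/v_decr/ltW ->//]; rewrite lexx.
rewrite (le_trans (leeD2r _ (le_hausdorff1 dec)))//.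
rewrite (le_trans (leeD2r _ (outer_measureU2 hausdorff1 _ _)))//.
rewrite addeAC; apply: leeD; last exact: outer_measure_sigma_subadditive_tail.
apply: le_trans (_ : _ <= hausdorff1 (X `&` [set p | (v n < g p)%R] `|`
    X `&` ~` [set p | (x < g p)%R])) _; last first.
  by apply: le_hausdorff1 => p [[]|[]].
apply: (@separated _ _ x (v n)).
- by rewrite ltrDl.
- by move=> p [_ /= /ltW].
- by move=> p [_ /= /negP]; rewrite -leNgt.
Qed.

End halfplane.

Lemma hausdorff1_halfplane (g : R * R -> R) :
  (forall p q, (`|g p - g q| <= dist2 p q)%R) ->
  forall x, hausdorff1.-caratheodory [set p | (x < g p)%R].
Proof.
move=> gl x; apply: le_caratheodory_measurable => X.
have [Xoo|] := eqVneq (hausdorff1 X) +oo; first by rewrite [leRHS]Xoo leey.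
by rewrite -ltey => Xoo; exact: hausdorff1_halfplane_le.
Qed.

Lemma hausdorff1_caratheodory_preimage (g : R * R -> R) :
  (forall p q, (`|g p - g q| <= dist2 p q)%R) ->
  forall B : set (measurableTypeR R), measurable B ->
  hausdorff1.-caratheodory (g @^-1` B).
Proof.
move=> gl B mB.
pose S : set (set R) := [set B | hausdorff1.-caratheodory (g @^-1` B)].
have sS : sigma_algebra setT S.
  split => [|A SA|A SA].
  - by rewrite /S/= preimage_set0; exact: caratheodory_measurable_set0.
  - by rewrite /S/= setTD preimage_setC; exact: caratheodory_measurable_setC.
  - by rewrite /S/= preimage_bigcup; exact: caratheodory_measurable_bigcup.
suff : (@RGenOInfty.G R).-sigma.-measurable `<=` S.
  by apply; rewrite -RGenOInfty.measurableE.
apply: smallest_sub => // _ [x ->]; rewrite /S/=.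
rewrite (_ : _ @^-1` _ = [set p | (x < g p)%R]); first exact: hausdorff1_halfplane.
by apply/seteqP; split => p /=; rewrite in_itv/= andbT.
Qed.

Lemma borel_hausdorff1_caratheodory (A : set plane) :
  measurable A -> hausdorff1.-caratheodory A.
Proof.
move=> mA; pose S : set (set (R * R)) := hausdorff1.-caratheodory.
have sS : sigma_algebra setT S.
  split => [|B SB|B SB].
  - exact: caratheodory_measurable_set0.
  - by rewrite setTD; exact: caratheodory_measurable_setC.
  - exact: caratheodory_measurable_bigcup.
have sqr_le (a b : R) : (`|a| <= Num.sqrt (a ^+ 2 + b ^+ 2))%R.
  by rewrite -sqrtr_sqr ler_wsqrtr// lerDl sqr_ge0.
apply: (@smallest_sub _ _ _ S sS _ _ mA) => C [] [B mB <-]; rewrite setTI.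
- by apply: hausdorff1_caratheodory_preimage => // p q; exact: sqr_le.
- by apply: hausdorff1_caratheodory_preimage => // p q; rewrite /dist2 [X in Num.sqrt X]addrC sqr_le.
Qed.

(* Length on Borel sets; on a Lipschitz boundary this is the surface measure *)
Definition length_measure (A : set plane) : \bar R := hausdorff1 A.

Let length_measure0 : length_measure set0 = 0.
Proof. exact: hausdorff1_0. Qed.

Let length_measure_ge0 A : 0 <= length_measure A.
Proof. exact: hausdorff1_ge0. Qed.

Let length_measure_sigma_additive : semi_sigma_additive length_measure.
Proof.
move=> F mF tF mUF.
apply: (@caratheodory_measure_sigma_additive R (R * R)%type hausdorff1 F) => //.
- by move=> i; exact: borel_hausdorff1_caratheodory.
- exact: borel_hausdorff1_caratheodory.
Qed.

HB.instance Definition _ := isMeasure.Build _ plane R length_measure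
  length_measure0 length_measure_ge0 length_measure_sigma_additive.

End hausdorff.

Section complex_integrals.
Context d (T : measurableType d) (R : realType).
Variables (mu : {measure set T -> \bar R}) (A : set T) (f : T -> R[i]).

Definition cintegral : R[i] :=
  ((\int[mu]_(x in A) complex.Re (f x)) +i*
   (\int[mu]_(x in A) complex.Im (f x)))%C.

Definition sqnorm : \bar R :=
  (\int[mu]_(x in A) ((ComplexField.Normc.normc (f x)) ^+ 2)%:E)%E.

Definition L2 : Prop :=
  [/\ measurable_fun A (fun x => complex.Re (f x)),
      measurable_fun A (fun x => complex.Im (f x)) & (sqnorm < +oo)%E].

End complex_integrals.

Section problem.
Context {R : realType}.
Local Notation plane := (measurableTypeR R * measurableTypeR R)%type.

Definition leb : {measure set (measurableTypeR R) -> \bar R} :=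
  @lebesgue_measure R.

Definition area : {measure set plane -> \bar R} :=
  (@lebesgue_measure R \x @lebesgue_measure R)%E.

Definition len : {measure set plane -> \bar R} := @length_measure R.

Definition frontier (Omega : set (R * R)) : set (R * R) :=
  closure Omega `\` interior Omega.

Definition Gamma : set (R * R) := [set p | -1 < p.1 < 1 /\ p.2 = 0].

(* Near each boundary point, after a rotation by an angle with cosine [c] and
   sine [s], [Omega] is the set of points above the graph of [gamma]. *)
Definition lipschitz_boundary (Omega : set (R * R)) : Prop :=
  forall p, frontier Omega p ->
  exists (r c s K : R) (gamma : R -> R),
    [/\ 0 < r, c ^+ 2 + s ^+ 2 = 1, K.-lipschitz gamma &
      forall q, ball p r q ->
        Omega q <-> gamma (c * q.1 + s * q.2) < - s * q.1 + c * q.2].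

(* Complex-valued functions are differentiated through their real and
   imaginary parts, since R[i] is not a normed module over R. *)
Definition ccontinuous (f : R * R -> R[i]) : Prop :=
  continuous (fun p => complex.Re (f p)) /\
  continuous (fun p => complex.Im (f p)).

Definition basis (i : 'I_2) : R * R := if i == ord0 then (1, 0) else (0, 1).

Definition pd (i : 'I_2) (f : R * R -> R[i]) (p : R * R) : R[i] :=
  ('D_(basis i) (fun q => complex.Re (f q)) p +i*
   'D_(basis i) (fun q => complex.Im (f q)) p)%C.

Definition pderivable (i : 'I_2) (f : R * R -> R[i]) : Prop :=
  forall p, derivable (fun q => complex.Re (f q)) p (basis i) /\
            derivable (fun q => complex.Im (f q)) p (basis i).

Definition C1 (f : R * R -> R[i]) : Prop :=
  ccontinuous f /\ forall i, pderivable i f /\ ccontinuous (pd i f).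

Definition smooth (f : R * R -> R[i]) : Prop :=
  forall s : seq 'I_2, C1 (foldr pd f s).

Definition test (Omega : set (R * R)) (phi : R * R -> R[i]) : Prop :=
  smooth phi /\ exists K : set (R * R), [/\ compact K, K `<=` Omega &
    forall p, ~ K p -> phi p = 0].

Definition cderive1 (f : R -> R[i]) (x : R) : R[i] :=
  (derive1 (fun y => complex.Re (f y)) x +i*
   derive1 (fun y => complex.Im (f y)) x)%C.

Definition smooth1 (f : R -> R[i]) : Prop :=
  forall n x, derivable (derive1n n (fun y => complex.Re (f y))) x 1 /\
              derivable (derive1n n (fun y => complex.Im (f y))) x 1.

(* Test functions on [`]0, 1[], which is identified with Gamma_+ *)
Definition test1 (phi : R -> R[i]) : Prop :=
  smooth1 phi /\ exists K : set R, [/\ compact K, K `<=` `]0, 1[ &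
    forall x, ~ K x -> phi x = 0].

(* Distributions are functionals, to be compared on test functions only. *)
Definition distr (Omega : set (R * R)) (v phi : R * R -> R[i]) : R[i] :=
  cintegral area Omega (fun p => v p * phi p).

Definition dpd (i : 'I_2) (T : (R * R -> R[i]) -> R[i])
    (phi : R * R -> R[i]) : R[i] :=
  - T (pd i phi).

Definition dlaplace (T : (R * R -> R[i]) -> R[i]) (phi : R * R -> R[i]) : R[i] :=
  \sum_(i < 2) dpd i (dpd i T) phi.

Definition distr1 (h phi : R -> R[i]) : R[i] :=
  cintegral leb `]0, 1[ (fun x => h x * phi x).

Definition ddx (T : (R -> R[i]) -> R[i]) (phi : R -> R[i]) : R[i] :=
  - T (cderive1 phi).

Definition clocally_integrable (h : R -> R[i]) : Prop :=
  locally_integrable `]0, 1[ (fun x => complex.Re (h x)) /\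
  locally_integrable `]0, 1[ (fun x => complex.Im (h x)).

(* [v] is in H^1(Omega), with distributional gradient [Gv] *)
Definition H1 (Omega : set (R * R)) (v : R * R -> R[i])
    (Gv : 'I_2 -> R * R -> R[i]) : Prop :=
  [/\ L2 area Omega v, forall i, L2 area Omega (Gv i) &
      forall i phi, test Omega phi ->
        distr Omega (Gv i) phi = dpd i (distr Omega v) phi].

Definition H1_sqnorm (Omega : set (R * R)) (v : R * R -> R[i])
    (Gv : 'I_2 -> R * R -> R[i]) : \bar R :=
  (sqnorm area Omega v + \sum_(i < 2) sqnorm area Omega (Gv i))%E.

(* [g] is the trace of [v] on the boundary: the trace operator is the
   continuous extension to H^1(Omega) of the restriction to the boundary of
   functions that are C^1 up to the boundary. Only the values of [g] on
   [frontier Omega] matter. *)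
Definition is_trace (Omega : set (R * R)) (v : R * R -> R[i])
    (Gv : 'I_2 -> R * R -> R[i]) (g : R * R -> R[i]) : Prop :=
  L2 len (frontier Omega) g /\
  exists w : nat -> R * R -> R[i],
    [/\ forall n, C1 (w n),
        H1_sqnorm Omega (fun p => w n p - v p)
          (fun i p => pd i (w n) p - Gv i p) @[n --> \oo] --> 0%E &
        sqnorm len (frontier Omega) (fun p => w n p - g p) @[n --> \oo] --> 0%E].

(* [dv] is the distributional derivative along Gamma_+ of the trace of [v] *)
Definition is_ddx_trace (Omega : set (R * R)) (v : R * R -> R[i])
    (Gv : 'I_2 -> R * R -> R[i]) (dv : R -> R[i]) : Prop :=
  clocally_integrable dv /\
  exists2 g, is_trace Omega v Gv g &
    forall phi, test1 phi -> distr1 dv phi = ddx (distr1 (fun x => g (x, 0))) phi.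

(* [v] is in V_alpha(Omega), with gradient [Gv] in [Omega] and with tangential
   derivative [dv] on Gamma_+; [v] determines [Gv] and [dv] almost everywhere. *)
Definition Valpha (Omega : set (R * R)) (alpha : R) (v : R * R -> R[i])
    (Gv : 'I_2 -> R * R -> R[i]) (dv : R -> R[i]) : Prop :=
  [/\ H1 Omega v Gv, is_ddx_trace Omega v Gv dv &
      L2 leb `]0, 1[ (fun x => (x `^ (alpha / 2))%:C%C * dv x)].

(* H^{1/2} is the range of the trace operator, with the quotient norm. *)
Definition H12 (Omega : set (R * R)) (g : R * R -> R[i]) : Prop :=
  exists v Gv, H1 Omega v Gv /\ is_trace Omega v Gv g.

Definition H12_norm (Omega : set (R * R)) (g : R * R -> R[i]) : R :=
  inf [set r | exists v Gv, [/\ H1 Omega v Gv, is_trace Omega v Gv g &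
    r = Num.sqrt (fine (H1_sqnorm Omega v Gv))]].

(* H^{-1/2}: bounded linear functionals on H^{1/2}; the values of [ell] off
   H^{1/2} are irrelevant. *)
Definition Hm12 (Omega : set (R * R)) (ell : (R * R -> R[i]) -> R[i]) : Prop :=
  (forall a g h, H12 Omega g -> H12 Omega h ->
     ell (fun p => a * g p + h p) = a * ell g + ell h) /\
  exists K : R, forall g, H12 Omega g ->
    ComplexField.Normc.normc (ell g) <= K * H12_norm Omega g.

(* [ell] is the normal derivative of [u], given by the Green formula, where
   [Lu] is the distributional Laplacian of [u]. *)
Definition is_normal_derivative (Omega : set (R * R)) (u : R * R -> R[i])
    (Gu : 'I_2 -> R * R -> R[i]) (ell : (R * R -> R[i]) -> R[i]) : Prop :=
  Hm12 Omega ell /\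
  exists Lu, [/\ L2 area Omega Lu,
    forall phi, test Omega phi ->
      distr Omega Lu phi = dlaplace (distr Omega u) phi &
    forall v Gv g, H1 Omega v Gv -> is_trace Omega v Gv g ->
      ell (fun p => conjc (g p)) =
      cintegral area Omega (fun p =>
        \sum_(i < 2) Gu i p * conjc (Gv i p) + Lu p * conjc (v p))].

(* [ell] vanishes on the part of the boundary outside the closure of Gamma_+. *)
Definition zero_off_Gammap (Omega : set (R * R))
    (ell : (R * R -> R[i]) -> R[i]) : Prop :=
  forall g, H12 Omega g ->
    {ae leb, forall x, 0 < x < 1 -> g (x, 0) = 0} ->
    ell (fun p => conjc (g p)) = 0.

Definition zero_ext (phi : R -> R[i]) (p : R * R) : R[i] :=
  if (p.2 == 0) && (0 < p.1 < 1) then phi p.1 else 0.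

(* The restriction of [ell] to Gamma_+ is the distribution [T]; test functions
   on Gamma_+ extended by zero are required to be in the domain of [ell]. *)
Definition eq_on_Gammap (Omega : set (R * R))
    (ell : (R * R -> R[i]) -> R[i]) (T : (R -> R[i]) -> R[i]) : Prop :=
  forall phi, test1 phi ->
    H12 Omega (zero_ext phi) /\ ell (zero_ext phi) = T phi.

End problem.

(* Main.v *)
Require Import Defs.
From HB Require Import structures.
From mathcomp Require Import all_boot all_order all_algebra.
From mathcomp Require Import all_classical all_reals all_analysis.
From mathcomp Require Import complex.
From mathcomp Require Import measurable_realfun.
From mathcomp Require Import ring lra.
Import Order.TTheory GRing.Theory Num.Theory numFieldNormedType.Exports.
Set Implicit Arguments.
Unset Strict Implicit.
Unset Printing Implicit Defensive.
Local Open Scope classical_set_scope.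
Local Open Scope ring_scope.

(** Testing the variational identity with different functions [v] gives the
    three conclusions one after the other. A test function on [Omega] has trace
    zero, so it is an admissible [v] for which the integral over [Gamma_+]
    vanishes; since the distributional gradient of [u] is [Gu], this is the
    equation [- Delta u + u = f]. In particular [Delta u = u - f] is square
    integrable, and the Green formula involves the pairing
    [green v = int Gu . conj Gv + (u - f) conj v].

    The variational identity says that [green v] is minus [s] times the integral
    over [Gamma_+] for every admissible [v]. A function of [H^1] whose trace
    vanishes almost everywhere on [Gamma_+] is admissible, with tangential
    derivative [0] ([Valpha_zero_trace]), so [green] vanishes on it. This is used
    twice. Functions with the same boundary values have the same [green], so
    that [green] induces a functional [normal_flux] on traces; it is bounded for
    the quotient norm because [green] is bounded on [H^1] ([green_bounded]). And
    this functional vanishes on traces that vanish on [Gamma_+], which is the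
    Neumann condition.

    For the condition on [Gamma_+], a test function [phi] on [Gamma_+] has to be
    the trace, once extended by zero to the boundary, of a function in
    [V_alpha]. The boundary contains the segment [Gamma] and is locally a
    Lipschitz graph; a graph containing a segment is that segment locally, so
    that the boundary lies on the axis near the support of [phi]
    ([frontier_flat_compact]). Hence [w(x,y) = phi(x) chi(y)], with [chi] a
    cutoff of small support, is a [C^1] function of the plane that agrees with
    the extension of [phi] on the whole boundary ([C1_extension]), and the
    variational identity for the conjugate of [w] is the claim. That [C^1]
    functions are in [H^1] amounts to integration by parts against test
    functions, that is to Fubini's theorem and the fundamental theorem of
    calculus ([integral_derive_eq0]). *)

Local Notation Re := complex.Re.
Local Notation Im := complex.Im.
Local Notation normc := ComplexField.Normc.normc.

(** * Real and imaginary parts *)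

Section complex_parts.
Context {R : realType}.
Implicit Types x y : R[i].

Lemma cReD x y : Re (x + y) = Re x + Re y.
Proof. by case: x; case: y. Qed.

Lemma cImD x y : Im (x + y) = Im x + Im y.
Proof. by case: x; case: y. Qed.

Lemma cReM x y : Re (x * y) = Re x * Re y - Im x * Im y.
Proof. by case: x; case: y. Qed.

Lemma cImM x y : Im (x * y) = Re x * Im y + Im x * Re y.
Proof. by case: x; case: y. Qed.

Lemma Re_conjc x : Re (conjc x) = Re x. Proof. by case: x. Qed.

Lemma Im_conjc x : Im (conjc x) = - Im x. Proof. by case: x. Qed.

Lemma complex_eq x y : Re x = Re y -> Im x = Im y -> x = y.
Proof. by case: x; case: y => ? ? ? ? /= -> ->. Qed.

Lemma sqr_normcE x : normc x ^+ 2 = Re x ^+ 2 + Im x ^+ 2.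
Proof. by case: x => a b /=; rewrite sqr_sqrtr// addr_ge0 ?sqr_ge0. Qed.

Lemma normc_ge0 x : 0 <= normc x.
Proof. by case: x => a b /=; rewrite sqrtr_ge0. Qed.

Lemma Re_le_normc x : `|Re x| <= normc x.
Proof.
by case: x => a b /=; rewrite -sqrtr_sqr ler_wsqrtr// lerDl sqr_ge0.
Qed.

Lemma Im_le_normc x : `|Im x| <= normc x.
Proof.
by case: x => a b /=; rewrite -sqrtr_sqr ler_wsqrtr// lerDr sqr_ge0.
Qed.

Lemma normc_le_ReIm x : normc x <= `|Re x| + `|Im x|.
Proof.
have a0 := normr_ge0 (Re x); have b0 := normr_ge0 (Im x).
rewrite -(@ler_pXn2r _ 2) ?nnegrE ?normc_ge0 ?addr_ge0//.
rewrite sqr_normcE -(real_normK (num_real (Re x))) -(real_normK (num_real (Im x))).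
nra.
Qed.

Lemma sqr_normc_conj x : normc (conjc x) ^+ 2 = normc x ^+ 2.
Proof. by rewrite !sqr_normcE Re_conjc Im_conjc sqrrN. Qed.

(** By the parallelogram identity, the difference of the two sides is
    [|a x - y|^2]. *)
Lemma sqr_normc_lincomb_le a x y :
  normc (a * x + y) ^+ 2 <= 2 * normc a ^+ 2 * normc x ^+ 2 + 2 * normc y ^+ 2.
Proof.
rewrite !sqr_normcE cReD cImD cReM cImM.
case: a x y => a b [c d] [e f] /=; rewrite -subr_ge0.
rewrite (_ : _ - _ = (a * c - b * d - e) ^+ 2 + (a * d + b * c - f) ^+ 2); last by ring.
by rewrite addr_ge0 ?sqr_ge0.
Qed.

(** Young's inequality: [l (|x| - |y| / l)^2 >= 0]. *)
Lemma normcM_le l x y : 0 < l ->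
  normc (x * y) <= (l * normc x ^+ 2 + l^-1 * normc y ^+ 2) / 2.
Proof.
move=> l0; rewrite ComplexField.Normc.normcM.
set a := normc x; set b := normc y.
rewrite ler_pdivlMr// -subr_ge0.
rewrite (_ : _ - _ = l * (a - l^-1 * b) ^+ 2); first by rewrite mulr_ge0 ?sqr_ge0// ltW.
by field; lra.
Qed.

End complex_parts.

(** * Square-integrable complex functions *)

Section complex_integration.
Context d (T : measurableType d) (R : realType).
Variables (mu : {measure set T -> \bar R}) (A : set T).
Hypothesis mA : measurable A.
Implicit Types f g : T -> R[i].

Definition cmeasurable f :=
  measurable_fun A (fun x => Re (f x)) /\ measurable_fun A (fun x => Im (f x)).

Definition cintegrable f :=
  mu.-integrable A (EFin \o (fun x => Re (f x))) /\
  mu.-integrable A (EFin \o (fun x => Im (f x))).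

Lemma measurable_sqr_normc f : cmeasurable f ->
  measurable_fun A (fun x => normc (f x) ^+ 2).
Proof.
move=> [mr mi]; rewrite (_ : (fun _ => _) = (fun x => Re (f x) ^+ 2 + Im (f x) ^+ 2)).
  by apply: measurable_funD; exact: measurable_funX.
by apply/funext => x; rewrite sqr_normcE.
Qed.

Lemma measurable_sqr_normcE f : cmeasurable f ->
  measurable_fun A (fun x => (normc (f x) ^+ 2)%:E).
Proof. by move=> mf; apply/measurable_EFinP/measurable_sqr_normc. Qed.

Lemma cmeasurable_lincomb (a : R[i]) f g : cmeasurable f -> cmeasurable g ->
  cmeasurable (fun x => a * f x + g x).
Proof.
move=> [fr fi] [gr gi]; split.
- under eq_fun do rewrite cReD cReM.
  by apply: measurable_funD => //; apply: measurable_funB; exact: measurable_funM.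
- under eq_fun do rewrite cImD cImM.
  by apply: measurable_funD => //; apply: measurable_funD; exact: measurable_funM.
Qed.

Lemma cmeasurableM f g : cmeasurable f -> cmeasurable g ->
  cmeasurable (fun x => f x * g x).
Proof.
move=> [fr fi] [gr gi]; split.
- under eq_fun do rewrite cReM.
  by apply: measurable_funB; exact: measurable_funM.
- under eq_fun do rewrite cImM.
  by apply: measurable_funD; exact: measurable_funM.
Qed.

Lemma cmeasurable_conj f : cmeasurable f -> cmeasurable (fun x => conjc (f x)).
Proof.
move=> [fr fi]; split; first by under eq_fun do rewrite Re_conjc.
by under eq_fun do rewrite Im_conjc; exact: measurableT_comp.
Qed.

Lemma L2_cmeasurable f : L2 mu A f -> cmeasurable f.
Proof. by case. Qed.

Lemma L2P f : L2 mu A f <-> cmeasurable f /\ (sqnorm mu A f < +oo)%E.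
Proof. by split => [[]//|[[]]]. Qed.

Lemma sqnorm_ge0 f : (0 <= sqnorm mu A f)%E.
Proof. by apply: integral_ge0 => x _; rewrite lee_fin sqr_ge0. Qed.

Lemma eq_sqnorm f g : (forall x, A x -> f x = g x) ->
  sqnorm mu A f = sqnorm mu A g.
Proof. by move=> fg; apply: eq_integral => x /set_mem/fg ->. Qed.

Lemma eq_cintegral f g : (forall x, A x -> f x = g x) ->
  cintegral mu A f = cintegral mu A g.
Proof.
by move=> fg; congr (_ +i* _)%C; apply: eq_Rintegral => x /set_mem/fg ->.
Qed.

Lemma sqnorm_conj f : sqnorm mu A (fun x => conjc (f x)) = sqnorm mu A f.
Proof. by apply: eq_integral => x _; rewrite sqr_normc_conj. Qed.

Lemma sqnorm_lincomb_le (a : R[i]) f g : cmeasurable f -> cmeasurable g ->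
  (sqnorm mu A (fun x => (a * f x + g x)%R)
   <= (2 * normc a ^+ 2)%R%:E * sqnorm mu A f + 2%:E * sqnorm mu A g)%E.
Proof.
move=> mf mg; rewrite /sqnorm.
have ms := measurable_sqr_normcE.
have k0 : 0 <= 2 * normc a ^+ 2 by rewrite mulr_ge0 ?sqr_ge0.
rewrite -!ge0_integralZl ?lee_fin//; try exact: ms;
  try by move=> x _; rewrite lee_fin sqr_ge0.
rewrite -ge0_integralD//; last 4 first.
- by move=> x _; rewrite mule_ge0 ?lee_fin// sqr_ge0.
- by apply: emeasurable_funM => //; exact: ms.
- by move=> x _; rewrite mule_ge0 ?lee_fin// sqr_ge0.
- by apply: emeasurable_funM => //; exact: ms.
apply: ge0_le_integral => //.
- by move=> x _; rewrite lee_fin sqr_ge0.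
- exact/ms/cmeasurable_lincomb.
- by apply: emeasurable_funD; apply: emeasurable_funM => //; exact: ms.
- by move=> x _; rewrite -!EFinM -EFinD lee_fin sqr_normc_lincomb_le.
Qed.

Lemma L2_lincomb (a : R[i]) f g : L2 mu A f -> L2 mu A g ->
  L2 mu A (fun x => a * f x + g x).
Proof.
move=> /L2P[mf f2] /L2P[mg g2]; apply/L2P; split; first exact: cmeasurable_lincomb.
apply: (le_lt_trans (sqnorm_lincomb_le a mf mg)).
apply: lte_add_pinfty; apply: lte_mul_pinfty => //.
by rewrite lee_fin mulr_ge0// sqr_ge0.
Qed.

Lemma L2_conj f : L2 mu A f -> L2 mu A (fun x => conjc (f x)).
Proof.
move=> /L2P[mf f2]; apply/L2P; split; first exact: cmeasurable_conj.
by rewrite sqnorm_conj.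
Qed.

Lemma L2_zero : L2 mu A (fun=> 0).
Proof.
split; [exact: measurable_cst|exact: measurable_cst|].
rewrite /sqnorm integral0_eq ?ltry// => x _.
by rewrite sqr_normcE/= expr0n/= addr0.
Qed.

Lemma L2_sqr_integrable f : L2 mu A f ->
  mu.-integrable A (EFin \o (fun x => normc (f x) ^+ 2)).
Proof.
move=> /L2P[mf f2]; apply/integrableP; split; first exact: measurable_sqr_normcE.
rewrite (eq_integral (fun x => (normc (f x) ^+ 2)%:E))// => x _ /=.
by rewrite ger0_norm ?sqr_ge0.
Qed.

Lemma cintegrable_le f (h : T -> R) : cmeasurable f ->
  (forall x, A x -> normc (f x) <= h x) -> mu.-integrable A (EFin \o h) ->
  cintegrable f.
Proof.
move=> [mr mi] fh ih; split; apply: (le_integrable mA _ _ ih) => //=;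
  try exact/measurable_EFinP.
- move=> x Ax; rewrite lee_fin (le_trans (Re_le_normc _))//.
  by rewrite (le_trans (fh x Ax)) ?ler_norm.
- move=> x Ax; rewrite lee_fin (le_trans (Im_le_normc _))//.
  by rewrite (le_trans (fh x Ax)) ?ler_norm.
Qed.

Lemma young_integrable l f g : L2 mu A f -> L2 mu A g ->
  mu.-integrable A
    (EFin \o (fun x => (l * normc (f x) ^+ 2 + l^-1 * normc (g x) ^+ 2) / 2)).
Proof.
move=> /L2_sqr_integrable f2 /L2_sqr_integrable g2.
under [X in _.-integrable _ X]eq_fun do rewrite /= mulrC EFinM EFinD !EFinM.
by apply: integrableZl => //; apply: integrableD => //; exact: integrableZl.
Qed.

Lemma L2M f g : L2 mu A f -> L2 mu A g -> cintegrable (fun x => f x * g x).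
Proof.
move=> f2 g2; apply: (cintegrable_le _ _ (young_integrable 1 f2 g2)).
  by apply: cmeasurableM; exact: L2_cmeasurable.
by move=> x _; exact: normcM_le.
Qed.

Lemma cintegrable_L2 f : cmeasurable f ->
  cintegrable (fun x => f x * conjc (f x)) -> L2 mu A f.
Proof.
move=> [mr mi] [/integrableP[_ int_lty] _]; split => //.
apply: le_lt_trans int_lty; rewrite le_eqVlt; apply/orP; left; apply/eqP.
apply: eq_integral => x _ /=; rewrite sqr_normcE cReM Re_conjc Im_conjc.
by rewrite mulrN opprK -!expr2 ger0_norm// addr_ge0// sqr_ge0.
Qed.

Lemma integrable_scale (c : R) (h : T -> R) : mu.-integrable A (EFin \o h) ->
  mu.-integrable A (EFin \o (fun x => c * h x)).
Proof.
move=> ih; under [X in _.-integrable _ X]eq_fun do rewrite /= EFinM.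
exact: integrableZl.
Qed.

Lemma cintegrable_lincomb (a : R[i]) f g : cintegrable f -> cintegrable g ->
  cintegrable (fun x => a * f x + g x).
Proof.
move=> [fr fi] [gr gi]; split.
- under [X in _.-integrable _ X]eq_fun do rewrite /= cReD cReM EFinD EFinB !EFinM.
  by apply: integrableD => //; apply: integrableB => //; exact: integrableZl.
- under [X in _.-integrable _ X]eq_fun do rewrite /= cImD cImM !EFinD !EFinM.
  by apply: integrableD => //; apply: integrableD => //; exact: integrableZl.
Qed.

Lemma cintegral_lincomb (a : R[i]) f g : cintegrable f -> cintegrable g ->
  cintegral mu A (fun x => a * f x + g x)
  = a * cintegral mu A f + cintegral mu A g.
Proof.
move=> [fr fi] [gr gi].
apply: complex_eq; rewrite ?(cReD, cImD, cReM, cImM) /=.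
- under eq_Rintegral do rewrite cReD cReM.
  rewrite RintegralD//; last by under [X in _.-integrable _ X]eq_fun do
      rewrite /= EFinB; apply: integrableB => //; exact: integrable_scale.
  by rewrite RintegralB ?RintegralZl//; exact: integrable_scale.
- under eq_Rintegral do rewrite cImD cImM.
  rewrite RintegralD//; last by under [X in _.-integrable _ X]eq_fun do
      rewrite /= EFinD; apply: integrableD => //; exact: integrable_scale.
  by rewrite RintegralD ?RintegralZl//; exact: integrable_scale.
Qed.

Lemma cintegralD f g : cintegrable f -> cintegrable g ->
  cintegral mu A (fun x => f x + g x) = cintegral mu A f + cintegral mu A g.
Proof.
move=> f1 g1; rewrite -[X in X + _]mul1r -cintegral_lincomb//.
by apply: eq_cintegral => x _; rewrite mul1r.
Qed.

Lemma cintegrableD f g : cintegrable f -> cintegrable g ->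
  cintegrable (fun x => f x + g x).
Proof.
move=> f1 g1; have := cintegrable_lincomb 1 f1 g1.
by under eq_fun do rewrite mul1r.
Qed.

Lemma cintegral0 : cintegral mu A (fun=> 0) = 0.
Proof. by rewrite /cintegral /= /Rintegral integral0. Qed.

Lemma cintegral_conj f : cintegrable f ->
  cintegral mu A (fun x => conjc (f x)) = conjc (cintegral mu A f).
Proof.
move=> [fr fi]; apply: complex_eq; rewrite /= ?(Re_conjc, Im_conjc)/=.
  by apply: eq_Rintegral => x _; rewrite Re_conjc.
rewrite -mulN1r -RintegralZl//.
by apply: eq_Rintegral => x _; rewrite Im_conjc mulN1r.
Qed.

Lemma cmeasurableB f g : cmeasurable f -> cmeasurable g ->
  cmeasurable (fun x => f x - g x).
Proof.
move=> mf mg; have := cmeasurable_lincomb (-1) mg mf.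
by under eq_fun do rewrite mulN1r addrC.
Qed.

Lemma normc_cintegral_le f (h : T -> R) : cmeasurable f ->
  (forall x, A x -> normc (f x) <= h x) -> mu.-integrable A (EFin \o h) ->
  normc (cintegral mu A f) <= 2 * \int[mu]_(x in A) h x.
Proof.
move=> mf fh ih; have [fr fi] := cintegrable_le mf fh ih.
have abs (g : T -> R) : mu.-integrable A (EFin \o g) ->
    (forall x, A x -> `|g x| <= h x) ->
    `|\int[mu]_(x in A) g x| <= \int[mu]_(x in A) h x.
  move=> ig gh; apply: (le_trans (le_normr_Rintegral mA ig)).
  by apply: le_Rintegral => //; exact: integrable_norm.
rewrite (le_trans (normc_le_ReIm _))//= mulr2n mulrDl mul1r lerD//.
- by apply: abs => // x Ax; rewrite (le_trans (Re_le_normc _)) ?fh.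
- by apply: abs => // x Ax; rewrite (le_trans (Im_le_normc _)) ?fh.
Qed.

(** Cauchy--Schwarz with a constant depending on [f]. Young's inequality with
    weight [l] bounds the pairing by [l |f|^2 + l^-1 |g|^2], and [l = |g|] is
    the right weight; when [g] vanishes, [l] is sent to [0]. *)
Lemma L2_pairing_le f g : L2 mu A f -> L2 mu A g ->
  normc (cintegral mu A (fun x => f x * g x))
  <= (fine (sqnorm mu A f) + 1) * Num.sqrt (fine (sqnorm mu A g)).
Proof.
move=> f2 g2.
set a := fine (sqnorm mu A f); set b := fine (sqnorm mu A g).
have a0 : 0 <= a by rewrite fine_ge0// sqnorm_ge0.
have b0 : 0 <= b by rewrite fine_ge0// sqnorm_ge0.
set N := normc _.
have young l : 0 < l -> N <= l * a + l^-1 * b.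
  move=> l0.
  have fI := L2_sqr_integrable f2; have gI := L2_sqr_integrable g2.
  have := @normc_cintegral_le (fun x => f x * g x) _
    (cmeasurableM (L2_cmeasurable f2) (L2_cmeasurable g2))
    (fun x _ => normcM_le (f x) (g x) l0) (young_integrable l f2 g2).
  rewrite (_ : (fun x => _ / 2) = (fun x => l / 2 * normc (f x) ^+ 2
    + l^-1 / 2 * normc (g x) ^+ 2)); last by apply/funext => x; lra.
  rewrite RintegralD//; [|exact: integrable_scale|exact: integrable_scale].
  rewrite !RintegralZl// -/a -/b.
  rewrite (_ : 2 * _ = l * a + l^-1 * b)// /a /b /sqnorm /Rintegral; lra.
have [b_eq0|b_neq0] := eqVneq b 0.
  rewrite b_eq0 sqrtr0 mulr0; apply/ler_addgt0Pr => e e0; rewrite add0r.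
  have l0 : 0 < e / (a + 1) by rewrite divr_gt0// ltr_wpDl.
  have := young _ l0; rewrite b_eq0 mulr0 addr0 => /le_trans; apply.
  rewrite mulrAC ler_pdivrMr ?ltr_wpDl//; nra.
have sb0 : 0 < Num.sqrt b by rewrite sqrtr_gt0 lt_neqAle eq_sym b_neq0.
have := young _ sb0; move/le_trans; apply.
rewrite -[X in _^-1 * X]sqr_sqrtr// expr2 mulKf ?gt_eqF//; nra.
Qed.

End complex_integration.

(** * Continuous functions of the plane are Borel and locally integrable *)

Section plane_topology.
Context {R : realType}.
Local Notation plane := (measurableTypeR R * measurableTypeR R)%type.

Let rball (c : rat * rat * nat) : set (R * R) :=
  ball ((ratr c.1.1, ratr c.1.2) : R * R) c.2.+1%:R^-1.

(** The sigma-algebra of the plane is the product one: an open set is the union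
    of the countably many balls that it contains with rational centre and radius
    of the form [1 / n], and these balls are squares. *)
Lemma measurable_open_plane (U : set (R * R)) :
  open U -> measurable (U : set plane).
Proof.
move=> oU.
pose G (o : option (rat * rat * nat)) : set plane := if o is Some c then
  (if pselect (rball c `<=` U) then rball c else set0) else set0.
have mG o : measurable (G o).
  rewrite /G; case: o => [c|]; last exact: measurable0.
  case: pselect => ? /=; last exact: measurable0.
  rewrite (_ : rball c =
    ball (ratr c.1.1 : R) c.2.+1%:R^-1 `*` ball (ratr c.1.2 : R) c.2.+1%:R^-1)//.
  by apply: measurableX; exact: measurable_ball.
pose F k := G (unpickle k).
have mF k : measurable (F k) by exact: mG.
rewrite (_ : U = \bigcup_k F k); first exact: bigcupT_measurable.
apply/seteqP; split => [p Up|p [k _]]; last first.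
  by rewrite /F /G; case: (unpickle k) => // c; case: pselect => // sU /sU.
have /nbhs_ballP[r /= r0 rU] : nbhs p U by exact: open_nbhs_nbhs.
have [n] := @ltr_add_invr R 0 (r / 2) (divr_gt0 r0 (ltr0Sn _ 1)).
rewrite add0r => nr.
have e0 : 0 < n.+1%:R^-1 :> R by rewrite invr_gt0.
have close (x : R) : exists q : rat, ball (ratr q : R) n.+1%:R^-1 x.
  have [|q] := @rat_in_itvoo R (x - n.+1%:R^-1) (x + n.+1%:R^-1).
    by rewrite ltrD2l gtrN.
  by rewrite in_itv/= => /andP[q1 q2]; exists q; rewrite /ball/= ltr_distl q1 q2.
have [[q1 pq1] [q2 pq2]] := (close p.1, close p.2).
have FE c : F (pickle c) = G (Some c) by rewrite /F pickleK.
exists (pickle (q1, q2, n)); first exact: I.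
rewrite FE /G; move: FE => _.
case: pselect => [?|]; first by split; rewrite /= .
case=> q [/= qq1 qq2]; apply: rU; split => /=.
- move: pq1 qq1; rewrite /ball/= => a b.
  have -> : p.1 - q.1 = - (ratr q1 - p.1) + (ratr q1 - q.1) by ring.
  rewrite (le_lt_trans (ler_normD _ _))// normrN [r]splitr; apply: ltrD; exact: lt_trans nr.
- move: pq2 qq2; rewrite /ball/= => a b.
  have -> : p.2 - q.2 = - (ratr q2 - p.2) + (ratr q2 - q.2) by ring.
  rewrite (le_lt_trans (ler_normD _ _))// normrN [r]splitr; apply: ltrD; exact: lt_trans nr.
Qed.

Lemma measurable_closed_plane (K : set (R * R)) :
  closed K -> measurable (K : set plane).
Proof.
move=> /closed_openC/measurable_open_plane mK.
by rewrite -[K]setCK; exact: measurableC.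
Qed.

Lemma compact_closed_plane (K : set (R * R)) : compact K -> closed K.
Proof. by apply: compact_closed; exact: (@norm_hausdorff R (R * R)%type). Qed.

Lemma measurable_frontier (Omega : set (R * R)) :
  measurable (frontier Omega : set plane).
Proof.
apply: measurableD.
  by apply: measurable_closed_plane; exact: closed_closure.
by apply: measurable_open_plane; exact: open_interior.
Qed.

Lemma continuous_measurable_plane (f : R * R -> R) (D : set plane) :
  continuous f -> measurable D -> measurable_fun D (f : plane -> R).
Proof.
move=> /continuousP cf mD; apply: (measurability _ (RGenOpens.measurableE R)).
move=> _ [_ [a [b ->] <-]]; apply: measurableI => //.
by apply: measurable_open_plane; apply: cf; exact: interval_open.
Qed.

Definition centered_square (M : R) : set (R * R) := `[- M, M] `*` `[- M, M].

Lemma bounded_sub_square (D : set (R * R)) : bounded_set D ->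
  exists2 M, 0 < M & D `<=` centered_square M.
Proof.
case=> M [_ MD]; exists (`|M| + 1) => [|p Dp]; first by rewrite ltr_wpDl.
have := MD (`|M| + 1) _ p Dp; rewrite /= prod_normE ge_max.
case/(_ _)/andP; first by rewrite (le_lt_trans (ler_norm M))// ltrDl.
by rewrite !ler_norml => p1 p2; split; rewrite /= in_itv/=.
Qed.

Lemma continuous_bounded_on (f : R * R -> R) (D : set (R * R)) :
  continuous f -> bounded_set D -> exists C, forall p, D p -> `|f p| <= C.
Proof.
move=> cf /bounded_sub_square[M M0 DM].
have cs : compact (centered_square M) by apply: compact_setX; exact: segment_compact.
have /compact_bounded[C [_ bC]] : compact (f @` centered_square M).
  by apply: continuous_compact => //; exact: continuous_subspaceT.
exists (C + 1) => p /DM Dp; apply: (bC (C + 1)) => /=; first by rewrite ltrDl.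
by exists p.
Qed.

Lemma area_bounded_lty (D : set plane) : measurable D -> bounded_set (D : set (R * R)) ->
  (area D < +oo)%E.
Proof.
move=> mD /bounded_sub_square[M M0 DM].
have m1 : measurable (`[- M, M] : set (measurableTypeR R)) by exact: measurable_itv.
apply: (@le_lt_trans _ _ (area (`[- M, M] `*` `[- M, M] : set plane))).
  by apply: le_measure => //; rewrite inE//; exact: measurableX.
have -> : area (`[- M, M] `*` `[- M, M] : set plane) =
    (@lebesgue_measure R `[(- M)%R, M] * @lebesgue_measure R `[(- M)%R, M])%E.
  exact: product_measure1E.
rewrite !lebesgue_measure_itv/=.
by case: ifP => // _; rewrite ?mule0// -EFinB -EFinM ltry.
Qed.

Lemma continuous_integrable_on (f : R * R -> R) (D : set plane) :
  continuous f -> measurable D -> bounded_set (D : set (R * R)) ->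
  area.-integrable D (EFin \o f).
Proof.
move=> cf mD bD; apply: measurable_bounded_integrable => //.
- exact: area_bounded_lty.
- exact: continuous_measurable_plane.
- have [C fC] := continuous_bounded_on cf bD; exists C; split; first exact: num_real.
  by move=> c Cc p Dp; apply: (le_trans (fC p Dp)); exact: ltW.
Qed.

Lemma continuous_integrable_compact_support (f : R * R -> R) (K : set (R * R)) :
  continuous f -> compact K -> (forall p, ~ K p -> f p = 0) ->
  area.-integrable setT (EFin \o f).
Proof.
move=> cf cK fK.
have mK : measurable (K : set plane).
  by apply: measurable_closed_plane; exact: compact_closed_plane.
have : area.-integrable (K : set plane) (EFin \o f).
  by apply: continuous_integrable_on => //; exact: compact_bounded.
rewrite (integrable_mkcond _ mK); congr (_.-integrable _ _).
apply/funext => p; rewrite patchE/=; case: ifPn => // /negP pK.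
by rewrite fK// => Kp; apply: pK; rewrite inE.
Qed.

End plane_topology.

(** * Integrals of partial derivatives with compact support *)

Section integration_by_parts.
Context {R : realType}.
Local Notation plane := (measurableTypeR R * measurableTypeR R)%type.
Implicit Types (h : R * R -> R) (w : R * R -> R[i]).

(** The two difference quotients are the same function. *)
Lemma derive_slice_fst h x y :
  (derivable h (x, y) (Defs.basis ord0) <-> derivable (fun t => h (t, y)) x 1) /\
  'D_(Defs.basis ord0) h (x, y) = derive1 (fun t => h (t, y)) x.
Proof.
rewrite derive1E /derivable /derive /Defs.basis eqxx.
have -> : (fun t : R => t^-1 *: ((h \o shift (x, y)) (t *: (1, 0)) - h (x, y))) =
  (fun t : R => t^-1 *: (((fun t => h (t, y)) \o shift x) (t *: 1) - h (x, y))).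
  apply/funext => t /=; congr (_ *: (h _ - _)).
  by congr (_, _); rewrite /= scaler0 add0r.
by split.
Qed.

Lemma derive_slice_snd h x y :
  (derivable h (x, y) (Defs.basis ord_max) <-> derivable (fun t => h (x, t)) y 1) /\
  'D_(Defs.basis ord_max) h (x, y) = derive1 (fun t => h (x, t)) y.
Proof.
rewrite derive1E /derivable /derive /Defs.basis /=.
have -> : (fun t : R => t^-1 *: ((h \o shift (x, y)) (t *: (0, 1)) - h (x, y))) =
  (fun t : R => t^-1 *: (((fun t => h (x, t)) \o shift y) (t *: 1) - h (x, y))).
  apply/funext => t /=; congr (_ *: (h _ - _)).
  by congr (_, _); rewrite /= scaler0 add0r.
by split.
Qed.

Lemma ord2P (i : 'I_2) : i = ord0 \/ i = ord_max.
Proof.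
by case: i => -[|[|//]] ?; [left|right]; exact/val_inj.
Qed.

(** The support lies in [[-N, N]] with [N] beyond [M], where the fundamental
    theorem of calculus gives the difference of two zeros. *)
Lemma integral_derive1_eq0 (F : R -> R) (M : R) :
  (forall x, derivable F x 1) -> continuous (derive1 F) ->
  (forall x, M <= `|x| -> F x = 0) ->
  (\int[lebesgue_measure]_x (derive1 F x)%:E = 0)%E.
Proof.
move=> dF cF F0.
pose N : R := `|M| + 1.
have N0 : 0 < N by rewrite ltr_wpDl.
have MN : M < N by rewrite (le_lt_trans (ler_norm M))// ltrDl.
have contF : continuous F.
  by move=> x; apply: differentiable_continuous; exact/derivable1_diffP.
have dF0 x : x \notin `[- N, N] -> derive1 F x = 0.
  move=> xN; have Nx : N < `|x|.
    by move: xN; rewrite in_itv/= -ler_norml -ltNge.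
  rewrite derive1E -(@derive_cst R R R 0 x 1); apply: near_eq_derive.
  have : \forall t \near x, M < `|t|.
    have : `|t| @[t --> x] --> `|x| by exact: norm_continuous.
    by move/cvgr_gt => /(_ _ (lt_trans MN Nx)).
  by apply: filterS => t /ltW/F0.
have -> : (\int[lebesgue_measure]_x (derive1 F x)%:E =
    \int[lebesgue_measure]_(x in `[(- N)%R, N]) (derive1 F x)%:E)%E.
  rewrite [RHS]integral_mkcond; apply: eq_integral => x _.
  rewrite patchE; case: ifPn => // /negP xN.
  by rewrite dF0//; apply/negP => xN'; apply: xN; rewrite inE.
have NN : - N < N by rewrite gtrN.
rewrite (continuous_FTC2 (F := F) NN).
- by rewrite !F0 ?normrN ?gtr0_norm ?ltW// sube0.
- exact: continuous_subspaceT.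
- split => [x _||]; first exact: dF.
  + by apply: cvg_at_right_filter; exact: contF.
  + by apply: cvg_at_left_filter; exact: contF.
- by [].
Qed.

Lemma derive_eq0_off h i (K : set (R * R)) : closed K ->
  (forall p, ~ K p -> h p = 0) ->
  forall p, ~ K p -> 'D_(Defs.basis i) h p = 0.
Proof.
move=> cK h0 p Kp; rewrite -(@derive_cst R (R * R)%type R 0 p (Defs.basis i)).
apply: near_eq_derive.
have : \forall q \near p, ~ K q.
  by apply: open_nbhs_nbhs; split => //; exact: closed_openC.
by apply: filterS => q /h0.
Qed.

(** By Fubini's theorem it suffices to integrate along the lines parallel to
    the direction of differentiation, where the fundamental theorem of calculus
    applies. *)
Lemma integral_derive_eq0 h i (K : set (R * R)) :
  (forall p, derivable h p (Defs.basis i)) -> continuous ('D_(Defs.basis i) h) ->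
  compact K -> (forall p, ~ K p -> h p = 0) ->
  (\int[area]_p ('D_(Defs.basis i) h p)%:E = 0)%E.
Proof.
move=> dh cdh cK h0.
have clK := compact_closed_plane cK.
have ih : area.-integrable setT (EFin \o 'D_(Defs.basis i) h).
  apply: (continuous_integrable_compact_support cdh cK).
  exact: derive_eq0_off.
have [M M0 KM] := bounded_sub_square (compact_bounded cK).
have h_far p : M + 1 <= `|p.1| \/ M + 1 <= `|p.2| -> h p = 0.
  move=> pM; apply: h0 => /KM[/=]; rewrite !in_itv/= -!ler_norml => p1 p2.
  by case: pM => /le_trans => [/(_ _ p1)|/(_ _ p2)]; rewrite gerDl leNgt ltr01.
have [i0|i1] := ord2P i; rewrite /area.
- rewrite -integral21_prod_meas1//.
  apply: integral0_eq => y _; rewrite /fubini_G i0.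
  under eq_integral do rewrite (derive_slice_fst h _ y).2.
  apply: (@integral_derive1_eq0 _ (M + 1)).
  + by move=> x; apply: (derive_slice_fst h x y).1.1; rewrite -i0; exact: dh.
  + rewrite (_ : derive1 _ = 'D_(Defs.basis ord0) h \o (fun t => (t, y))).
      move=> x; apply: continuous_comp; last by rewrite -i0; exact: cdh.
      by apply: (@cvg_pair _ _ _ _ (nbhs x) (nbhs y)); [exact: cvg_id|exact: cvg_cst].
    by apply/funext => x; rewrite /= (derive_slice_fst h x y).2.
  + by move=> x xM; apply: h_far; left.
- rewrite -integral12_prod_meas1//.
  apply: integral0_eq => x _; rewrite /fubini_F i1.
  under eq_integral do rewrite (derive_slice_snd h x _).2.
  apply: (@integral_derive1_eq0 _ (M + 1)).
  + by move=> y; apply: (derive_slice_snd h x y).1.1; rewrite -i1; exact: dh.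
  + rewrite (_ : derive1 _ = 'D_(Defs.basis ord_max) h \o (fun t => (x, t))).
      move=> y; apply: continuous_comp; last by rewrite -i1; exact: cdh.
      by apply: (@cvg_pair _ _ _ _ (nbhs x) (nbhs y)); [exact: cvg_cst|exact: cvg_id].
    by apply/funext => y; rewrite /= (derive_slice_snd h x y).2.
  + by move=> y yM; apply: h_far; right.
Qed.

End integration_by_parts.

(** * Complex functions of class C^1 *)

Section c1_functions.
Context {R : realType}.
Local Notation plane := (measurableTypeR R * measurableTypeR R)%type.
Implicit Types (v w phi : R * R -> R[i]) (Omega K : set (R * R)).

Lemma pd_lincomb i (a : R[i]) v w : pderivable i v -> pderivable i w ->
  pderivable i (fun p => a * v p + w p) /\
  pd i (fun p => a * v p + w p) = (fun p => a * pd i v p + pd i w p).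
Proof.
move=> dv dw.
have ReE : (fun p => Re (a * v p + w p)) =
    (Re a \*: (fun p => Re (v p))) - (Im a \*: (fun p => Im (v p)))
    + (fun p => Re (w p)).
  by apply/funext => p; rewrite cReD cReM.
have ImE : (fun p => Im (a * v p + w p)) =
    (Re a \*: (fun p => Im (v p))) + (Im a \*: (fun p => Re (v p)))
    + (fun p => Im (w p)).
  by apply/funext => p; rewrite cImD cImM.
have D1 p := (dv p).1; have D2 p := (dv p).2.
have D3 p := (dw p).1; have D4 p := (dw p).2.
split => [p|].
  rewrite ReE ImE; split.
  - by apply: derivableD => //; apply: derivableB; exact: derivableZ.
  - by apply: derivableD => //; apply: derivableD; exact: derivableZ.
apply/funext => p; rewrite {1}/pd ReE ImE.
rewrite deriveD//; last by apply: derivableB; exact: derivableZ.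
rewrite deriveB; [|exact: derivableZ|exact: derivableZ].
rewrite [X in (_ +i* X)%C]deriveD//; last by apply: derivableD; exact: derivableZ.
rewrite [X in (_ +i* (X + _))%C]deriveD; [|exact: derivableZ|exact: derivableZ].
rewrite !deriveZ//.
by apply: complex_eq; rewrite /= ?(cReD, cImD, cReM, cImM).
Qed.

Lemma pdM i v w : pderivable i v -> pderivable i w ->
  pderivable i (fun p => v p * w p) /\
  pd i (fun p => v p * w p) = (fun p => pd i v p * w p + v p * pd i w p).
Proof.
move=> dv dw.
have ReE : (fun p => Re (v p * w p)) =
    (fun p => Re (v p)) * (fun p => Re (w p))
    - (fun p => Im (v p)) * (fun p => Im (w p)).
  by apply/funext => p; rewrite cReM.
have ImE : (fun p => Im (v p * w p)) =
    (fun p => Re (v p)) * (fun p => Im (w p))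
    + (fun p => Im (v p)) * (fun p => Re (w p)).
  by apply/funext => p; rewrite cImM.
have D1 p := (dv p).1; have D2 p := (dv p).2.
have D3 p := (dw p).1; have D4 p := (dw p).2.
split => [p|].
  rewrite ReE ImE; split.
  - by apply: derivableB; exact: derivableM.
  - by apply: derivableD; exact: derivableM.
apply/funext => p; rewrite {1}/pd ReE ImE.
rewrite deriveB; [|exact: derivableM|exact: derivableM].
rewrite deriveD; [|exact: derivableM|exact: derivableM].
rewrite !deriveM//; apply: complex_eq; rewrite /= ?(cReD, cImD, cReM, cImM) /pd /=.
- move: ('D_ _ _ _) ('D_ _ _ _) ('D_ _ _ _) ('D_ _ _ _) => ? ? ? ?.
  by rewrite /GRing.scale/=; ring.
- move: ('D_ _ _ _) ('D_ _ _ _) ('D_ _ _ _) ('D_ _ _ _) => ? ? ? ?.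
  by rewrite /GRing.scale/=; ring.
Qed.

Lemma pd_conj i v : pderivable i v ->
  pderivable i (fun p => conjc (v p)) /\
  pd i (fun p => conjc (v p)) = (fun p => conjc (pd i v p)).
Proof.
move=> dv.
have ReE : (fun p => Re (conjc (v p))) = (fun p => Re (v p)).
  by apply/funext => p; rewrite Re_conjc.
have ImE : (fun p => Im (conjc (v p))) = - (fun p => Im (v p)).
  by apply/funext => p; rewrite Im_conjc.
split => [p|].
  rewrite ReE ImE; split; first exact: (dv p).1.
  by apply: derivableN; exact: (dv p).2.
apply/funext => p; rewrite {1}/pd ReE ImE deriveN//.
exact: (dv p).2.
Qed.

Lemma ccontinuous_lincomb (a : R[i]) v w : ccontinuous v -> ccontinuous w ->
  ccontinuous (fun p => a * v p + w p).
Proof.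
move=> [v1 v2] [w1 w2]; split.
- under eq_fun do rewrite cReD cReM.
  by move=> p; apply: cvgD; [apply: cvgB; apply: cvgMr; [exact: v1|exact: v2]|exact: w1].
- under eq_fun do rewrite cImD cImM.
  by move=> p; apply: cvgD; [apply: cvgD; apply: cvgMr; [exact: v2|exact: v1]|exact: w2].
Qed.

Lemma ccontinuousM v w : ccontinuous v -> ccontinuous w ->
  ccontinuous (fun p => v p * w p).
Proof.
move=> [v1 v2] [w1 w2]; split.
- under eq_fun do rewrite cReM.
  by move=> p; apply: cvgB; apply: cvgM; [exact: v1|exact: w1|exact: v2|exact: w2].
- under eq_fun do rewrite cImM.
  by move=> p; apply: cvgD; apply: cvgM; [exact: v1|exact: w2|exact: v2|exact: w1].
Qed.

Lemma ccontinuous_conj v : ccontinuous v -> ccontinuous (fun p => conjc (v p)).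
Proof.
move=> [v1 v2]; split.
- under eq_fun do rewrite Re_conjc.
  exact: v1.
- under eq_fun do rewrite Im_conjc.
  by move=> p; apply: cvgN; exact: v2.
Qed.

Lemma ccontinuous0 : ccontinuous (fun=> 0 : R[i]).
Proof. by split => p; exact: cvg_cst. Qed.

Lemma ccontinuousD v w : ccontinuous v -> ccontinuous w ->
  ccontinuous (fun p => v p + w p).
Proof.
move=> cv cw; have := ccontinuous_lincomb 1 cv cw.
by under eq_fun do rewrite mul1r.
Qed.

Lemma C1_lincomb (a : R[i]) v w : C1 v -> C1 w -> C1 (fun p => a * v p + w p).
Proof.
move=> [cv dv] [cw dw]; split; first exact: ccontinuous_lincomb.
move=> i; have [d ->] := pd_lincomb a (dv i).1 (dw i).1.
by split => //; apply: ccontinuous_lincomb; [exact: (dv i).2|exact: (dw i).2].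
Qed.

Lemma C1M v w : C1 v -> C1 w -> C1 (fun p => v p * w p).
Proof.
move=> [cv dv] [cw dw]; split; first exact: ccontinuousM.
move=> i; have [d ->] := pdM (dv i).1 (dw i).1; split => //.
by apply: ccontinuousD; apply: ccontinuousM => //; [exact: (dv i).2|exact: (dw i).2].
Qed.

Lemma C1_conj v : C1 v -> C1 (fun p => conjc (v p)).
Proof.
move=> [cv dv]; split; first exact: ccontinuous_conj.
move=> i; have [d ->] := pd_conj (dv i).1.
by split => //; apply: ccontinuous_conj; exact: (dv i).2.
Qed.

Lemma pderivable_C1 i v : C1 v -> pderivable i v.
Proof. by move=> [_ /(_ i)[]]. Qed.

Lemma ccontinuous_pd i v : C1 v -> ccontinuous (pd i v).
Proof. by move=> [_ /(_ i)[]]. Qed.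

Lemma test_C1 Omega phi : test Omega phi -> C1 phi.
Proof. by move=> [sphi _]; exact: (sphi [::]). Qed.

Lemma pd_eq0_off i w K : closed K -> (forall p, ~ K p -> w p = 0) ->
  forall p, ~ K p -> pd i w p = 0.
Proof.
move=> cK w0 p Kp; rewrite /pd !(derive_eq0_off _ cK)// => q /w0 ->//.
Qed.

(** Smoothness is stated for iterated partial derivatives, so that one more
    derivative only lengthens the list of directions. *)
Lemma test_pd Omega i phi : test Omega phi -> test Omega (pd i phi).
Proof.
move=> [sphi [K [cK KO phi0]]]; split => [s|].
  by rewrite -foldr_rcons; exact: sphi.
exists K; split => //; apply: pd_eq0_off => //; exact: compact_closed_plane.
Qed.

Lemma test_conj Omega phi : test Omega phi -> test Omega (fun p => conjc (phi p)).
Proof.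
move=> [sphi [K [cK KO phi0]]]; split => [s|]; last first.
  by exists K; split => // p /phi0 ->; rewrite conjc0.
rewrite (_ : foldr _ _ _ = fun p => conjc (foldr pd phi s p)).
  by apply: C1_conj; exact: sphi.
elim: s => //= i s ->.
exact: (pd_conj (pderivable_C1 i (sphi s))).2.
Qed.

Lemma cmeasurable_ccontinuous (D : set plane) w :
  measurable D -> ccontinuous w -> cmeasurable D (w : plane -> R[i]).
Proof.
by move=> mD [w1 w2]; split; exact: continuous_measurable_plane.
Qed.

Lemma cintegrable_ccontinuous (D : set plane) w : measurable D ->
  bounded_set (D : set (R * R)) -> ccontinuous w -> cintegrable area D w.
Proof.
by move=> mD bD [w1 w2]; split; exact: continuous_integrable_on.
Qed.

Lemma L2_ccontinuous (D : set plane) w : measurable D ->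
  bounded_set (D : set (R * R)) -> ccontinuous w -> L2 area D w.
Proof.
move=> mD bD cw; apply: cintegrable_L2; first exact: cmeasurable_ccontinuous.
by apply: cintegrable_ccontinuous => //; apply: ccontinuousM => //; exact: ccontinuous_conj.
Qed.

(** Integration by parts is applied as this statement for a product: a function
    supported in [Omega] has the same integral over [Omega] and over the plane. *)
Lemma cintegral_pd_eq0 Omega i w K : C1 w -> measurable (Omega : set plane) ->
  compact K -> K `<=` Omega -> (forall p, ~ K p -> w p = 0) ->
  cintegral area Omega (pd i w) = 0.
Proof.
move=> cw mO cK KO w0.
have pd0 := pd_eq0_off i (compact_closed_plane cK) w0.
have [c1 c2] := ccontinuous_pd i cw.
have part (h : R * R -> R) : (forall p, derivable h p (Defs.basis i)) ->
    continuous ('D_(Defs.basis i) h) -> (forall p, ~ K p -> h p = 0) ->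
    \int[area]_(p in Omega) 'D_(Defs.basis i) h p = 0.
  move=> dh ch h0; rewrite Rintegral_mkcond /Rintegral.
  transitivity (fine (\int[area]_p ('D_(Defs.basis i) h p)%:E)%E).
    congr fine; apply: eq_integral => p _; rewrite patchE; case: ifPn => // /negP pO.
    rewrite (derive_eq0_off _ (compact_closed_plane cK) h0)// => /KO Op.
    by apply: pO; rewrite inE.
  by rewrite (integral_derive_eq0 dh ch cK h0).
apply: complex_eq.
- apply: (part _ _ c1) => [p|p /w0 ->//]; exact: (pderivable_C1 i cw p).1.
- apply: (part _ _ c2) => [p|p /w0 ->//]; exact: (pderivable_C1 i cw p).2.
Qed.

End c1_functions.

(** * Linearity of H^1 and of the trace *)

Section sqnorm_convergence.
Context d (T : measurableType d) (R : realType).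
Variables (mu : {measure set T -> \bar R}) (A : set T).
Hypothesis mA : measurable A.
Implicit Types f g : nat -> T -> R[i].

Lemma cvg_sqnorm_lincomb (a : R[i]) f g :
  (forall n, cmeasurable A (f n)) -> (forall n, cmeasurable A (g n)) ->
  sqnorm mu A (f n) @[n --> \oo] --> 0%E ->
  sqnorm mu A (g n) @[n --> \oo] --> 0%E ->
  sqnorm mu A (fun x => a * f n x + g n x) @[n --> \oo] --> 0%E.
Proof.
move=> mf mg f0 g0.
apply: (@squeeze_cvge _ _ _ _ (cst 0%E) _ (fun n =>
  (2 * normc a ^+ 2)%R%:E * sqnorm mu A (f n) + 2%:E * sqnorm mu A (g n))%E).
- by apply: nearW => n; rewrite sqnorm_ge0 sqnorm_lincomb_le.
- exact: cvg_cst.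
- rewrite -[X in _ --> X]adde0; apply: cvgeD => //.
  + by rewrite -[X in _ --> X](mule0 (2 * normc a ^+ 2)%:E); exact: cvgeZl.
  + by rewrite -[X in _ --> X](mule0 2%:E); exact: cvgeZl.
Qed.

End sqnorm_convergence.

Section sobolev.
Context {R : realType}.
Local Notation plane := (measurableTypeR R * measurableTypeR R)%type.
Variable Omega : set (R * R).
Hypotheses (openO : open Omega) (boundedO : bounded_set Omega).
Implicit Types (v w g : R * R -> R[i]) (Gv : 'I_2 -> R * R -> R[i]).

Lemma measurable_domain : measurable (Omega : set plane).
Proof. exact: measurable_open_plane. Qed.
Local Notation mO := measurable_domain.

Lemma cvg_H1_sqnorm (f : nat -> R * R -> R[i])
    (Gf : nat -> 'I_2 -> R * R -> R[i]) :
  H1_sqnorm Omega (f n) (Gf n) @[n --> \oo] --> 0%E <->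
  sqnorm area Omega (f n) @[n --> \oo] --> 0%E /\
  forall i, sqnorm area Omega (Gf n i) @[n --> \oo] --> 0%E.
Proof.
have s0 h := @sqnorm_ge0 _ plane R area Omega h.
split => [H0|[f0 G0]]; last first.
  have s_cvg : (sqnorm area Omega (f n) + (sqnorm area Omega (Gf n ord0) +
      sqnorm area Omega (Gf n (lift ord0 ord0))))%E @[n --> \oo] --> (0 + (0 + 0))%E.
    by apply: cvgeD => //; exact: cvgeD.
  rewrite !adde0 in s_cvg; apply: cvg_trans s_cvg; apply: near_eq_cvg.
  by apply: nearW => n; rewrite /H1_sqnorm big_ord_recl big_ord1.
have dom (F : nat -> \bar R) : (forall n, 0 <= F n)%E ->
    (forall n, F n <= H1_sqnorm Omega (f n) (Gf n))%E -> F n @[n --> \oo] --> 0%E.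
  move=> F0 FH; apply: (squeeze_cvge _ (cvg_cst 0%E) H0).
  by apply: nearW => n; rewrite F0 FH.
split => [|i]; apply: dom => n //; rewrite /H1_sqnorm.
- by rewrite leeDl// sume_ge0.
- by rewrite (bigD1 i)//= addeCA leeDl// adde_ge0// sume_ge0.
Qed.

Lemma H1_lincomb (a : R[i]) v Gv w Gw : H1 Omega v Gv -> H1 Omega w Gw ->
  H1 Omega (fun p => a * v p + w p) (fun i p => a * Gv i p + Gw i p).
Proof.
move=> [v2 Gv2 vd] [w2 Gw2 wd]; split => [|i|i phi tphi].
- exact: (L2_lincomb mO a v2 w2).
- exact: (L2_lincomb mO a (Gv2 i) (Gw2 i)).
have phi2 : L2 area Omega phi by apply: (L2_ccontinuous mO boundedO (test_C1 tphi).1).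
have psi2 : L2 area Omega (pd i phi).
  by apply: (L2_ccontinuous mO boundedO (test_C1 (test_pd i tphi)).1).
have := vd i _ tphi; have := wd i _ tphi; rewrite /dpd /distr => wdi vdi.
under eq_cintegral do rewrite mulrDl -mulrA.
rewrite cintegral_lincomb; [|exact: mO|exact: (L2M mO (Gv2 i))|exact: (L2M mO (Gw2 i))].
rewrite wdi vdi.
under [in RHS]eq_cintegral do rewrite mulrDl -mulrA.
rewrite [in RHS]cintegral_lincomb; [|exact: mO|exact: (L2M mO v2)|exact: (L2M mO w2)].
by rewrite mulrN opprD.
Qed.

Lemma H1_conj v Gv : H1 Omega v Gv ->
  H1 Omega (fun p => conjc (v p)) (fun i p => conjc (Gv i p)).
Proof.
move=> [v2 Gv2 vd]; split => [|i|i phi tphi]; [exact: L2_conj|exact: L2_conj|].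
have phi2 w : C1 w -> L2 area Omega w.
  by move=> cw; exact: (L2_ccontinuous mO boundedO cw.1).
have dist_conj w psi : L2 area Omega w -> L2 area Omega psi ->
    distr Omega (fun p => conjc (w p)) psi =
    conjc (distr Omega w (fun p => conjc (psi p))).
  move=> w2 psi2; rewrite /distr -cintegral_conj; [|exact: mO|]; last first.
    by apply: L2M => //; [exact: mO|exact: L2_conj].
  by apply: eq_cintegral => p _; rewrite rmorphM/= conjcK.
have cphi := test_C1 tphi; have cdphi := test_C1 (test_pd i tphi).
rewrite /dpd !dist_conj//; [|exact: phi2|exact: phi2].
by rewrite (vd i _ (test_conj tphi)) /dpd (pd_conj (pderivable_C1 i cphi)).2 rmorphN.
Qed.

(** The classical gradient is the distributional one because the integral of
    [pd i (w * phi)] vanishes for a test function [phi]. *)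
Lemma H1_C1 w : C1 w -> H1 Omega w (fun i => pd i w).
Proof.
move=> cw; split => [|i|i phi tphi].
- exact: L2_ccontinuous mO boundedO cw.1.
- by apply: (L2_ccontinuous mO boundedO); exact: ccontinuous_pd.
have cphi := test_C1 tphi; case: (tphi) => _ [K [cK KO phi0]].
have := cintegral_pd_eq0 i (C1M cw cphi) mO cK KO.
rewrite (pdM (pderivable_C1 i cw) (pderivable_C1 i cphi)).2 => /(_ _)/wrap[].
  by move=> p /phi0 ->; rewrite mulr0.
have int (f g : R * R -> R[i]) : ccontinuous f -> ccontinuous g ->
    cintegrable area Omega (fun p => f p * g p).
  by move=> cf cg; apply: (cintegrable_ccontinuous mO boundedO); exact: ccontinuousM.
rewrite cintegralD; first last.
- by apply: int; [exact: cw.1|exact: ccontinuous_pd].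
- by apply: int; [exact: ccontinuous_pd|exact: cphi.1].
- exact: mO.
by move/eqP; rewrite addr_eq0 => /eqP.
Qed.

Lemma cmeasurable_C1B w v (D : set plane) : measurable D -> C1 w ->
  cmeasurable D v -> cmeasurable D (fun p => w p - v p).
Proof.
by move=> mD cw mv; apply: cmeasurableB => //; exact: cmeasurable_ccontinuous cw.1.
Qed.

(** The approximating sequences are combined; squared norms are only
    quasi-additive, which is enough for convergence to [0]. *)
Lemma is_trace_lincomb (a : R[i]) v Gv g v' Gv' g' :
  H1 Omega v Gv -> H1 Omega v' Gv' ->
  is_trace Omega v Gv g -> is_trace Omega v' Gv' g' ->
  is_trace Omega (fun p => a * v p + v' p) (fun i p => a * Gv i p + Gv' i p)
    (fun p => a * g p + g' p).
Proof.
have mF := measurable_frontier Omega.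
move=> [/L2_cmeasurable mv mGv _] [/L2_cmeasurable mv' mGv' _].
move=> [g2 [w [cw /cvg_H1_sqnorm[wv wGv] wg]]].
move=> [g'2 [w' [cw' /cvg_H1_sqnorm[wv' wGv'] wg']]].
split; first exact: L2_lincomb.
exists (fun n p => a * w n p + w' n p); split.
- by move=> n; exact: C1_lincomb.
- apply/cvg_H1_sqnorm; split => [|i].
  + rewrite (_ : (fun n => _) = (fun n => sqnorm area Omega (fun p =>
      a * (w n p - v p) + (w' n p - v' p)))).
      apply: (cvg_sqnorm_lincomb mO) => //.
      * by move=> n; apply: cmeasurable_C1B => //; exact: mO.
      * by move=> n; apply: cmeasurable_C1B => //; exact: mO.
    by apply/funext => n; apply: eq_sqnorm => p _; ring.
  + rewrite (_ : (fun n => _) = (fun n => sqnorm area Omega (fun p =>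
      a * (pd i (w n) p - Gv i p) + (pd i (w' n) p - Gv' i p)))).
      apply: (cvg_sqnorm_lincomb mO) => //.
      * move=> n; apply: cmeasurableB.
          by apply: cmeasurable_ccontinuous; [exact: mO|exact: ccontinuous_pd].
        exact: L2_cmeasurable (mGv i).
      * move=> n; apply: cmeasurableB.
          by apply: cmeasurable_ccontinuous; [exact: mO|exact: ccontinuous_pd].
        exact: L2_cmeasurable (mGv' i).
    apply/funext => n; apply: eq_sqnorm => p _.
    by rewrite (pd_lincomb a (pderivable_C1 i (cw n)) (pderivable_C1 i (cw' n))).2; ring.
- rewrite (_ : (fun n => _) = (fun n => sqnorm len (frontier Omega) (fun p =>
    a * (w n p - g p) + (w' n p - g' p)))).
    apply: cvg_sqnorm_lincomb => //.
    * by move=> n; apply: cmeasurable_C1B => //; exact: L2_cmeasurable g2.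
    * by move=> n; apply: cmeasurable_C1B => //; exact: L2_cmeasurable g'2.
  by apply/funext => n; apply: eq_sqnorm => p _; ring.
Qed.

Lemma is_trace_conj v Gv g : is_trace Omega v Gv g ->
  is_trace Omega (fun p => conjc (v p)) (fun i p => conjc (Gv i p))
    (fun p => conjc (g p)).
Proof.
move=> [g2 [w [cw /cvg_H1_sqnorm[wv wGv] wg]]].
have conj_cvg d (T : measurableType d) (mu : {measure set T -> \bar R}) A
    (F G : nat -> T -> R[i]) : (forall n x, G n x = conjc (F n x)) ->
    sqnorm mu A (F n) @[n --> \oo] --> 0%E -> sqnorm mu A (G n) @[n --> \oo] --> 0%E.
  move=> GF; rewrite (_ : (fun n => sqnorm mu A (G n)) = (fun n => sqnorm mu A (F n)))//.
  by apply/funext => n; rewrite -sqnorm_conj; apply: eq_sqnorm => x _; rewrite GF conjcK.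
split; first exact: L2_conj.
exists (fun n p => conjc (w n p)); split.
- by move=> n; exact: C1_conj.
- apply/cvg_H1_sqnorm; split => [|i].
  + by apply: conj_cvg wv => n p; rewrite rmorphB.
  + apply: conj_cvg (wGv i) => n p.
    by rewrite (pd_conj (pderivable_C1 i (cw n))).2 rmorphB.
- by apply: conj_cvg wg => n p; rewrite rmorphB.
Qed.

(** The constant sequence [w] is an admissible approximation. *)
Lemma is_trace_C1 w g : C1 w -> L2 len (frontier Omega) g ->
  (forall p, frontier Omega p -> w p = g p) ->
  is_trace Omega w (fun i => pd i w) g.
Proof.
move=> cw g2 wg; split => //; exists (fun=> w).
have z d (T : measurableType d) (mu : {measure set T -> \bar R}) (A : set T)
    (f h : T -> R[i]) : (forall x, A x -> f x = h x) ->
    sqnorm mu A (fun x => f x - h x) @[n --> \oo] --> 0%E.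
  move=> fh; rewrite (_ : sqnorm _ _ _ = 0%E); first exact: cvg_cst.
  apply: integral0_eq => x /fh ->.
  by rewrite subrr sqr_normcE/= expr0n/= addr0.
by split => //; [apply/cvg_H1_sqnorm; split => [|i]; exact: z|exact: z].
Qed.

End sobolev.

(** * Test functions on the unit interval *)

Section interval.
Context {R : realType}.
Implicit Types phi psi : R -> R[i].

Definition cderivable phi := forall x,
  derivable (fun y => Re (phi y)) x 1 /\ derivable (fun y => Im (phi y)) x 1.

Definition ccontinuous1 phi :=
  continuous (fun y => Re (phi y)) /\ continuous (fun y => Im (phi y)).

Lemma cderivable_continuous phi : cderivable phi -> ccontinuous1 phi.
Proof.
by move=> dphi; split => x; apply: differentiable_continuous;
  apply/derivable1_diffP; have [] := dphi x.
Qed.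

Lemma smooth1_cderivable phi : smooth1 phi -> cderivable phi.
Proof. by move=> sphi x; exact: (sphi 0 x). Qed.

Lemma derive1nS_derive1 n (f : R -> R) : derive1n n (derive1 f) = derive1n n.+1 f.
Proof. by rewrite /derive1n -iterSr. Qed.

Lemma smooth1_cderive1 phi : smooth1 phi -> smooth1 (cderive1 phi).
Proof. by move=> sphi n x; have := sphi n.+1 x; rewrite -!derive1nS_derive1. Qed.

Lemma cmeasurable_ccontinuous1 phi (D : set R) : measurable D ->
  ccontinuous1 phi -> cmeasurable (D : set (measurableTypeR R)) phi.
Proof.
by move=> mD [c1 c2]; split; apply: measurable_funTS;
  exact: continuous_measurable_fun.
Qed.

Lemma continuous_bounded01 (f : R -> R) : continuous f ->
  exists C, forall x, 0 < x < 1 -> `|f x| <= C.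
Proof.
move=> cf; have /compact_bounded[C [_ bC]] : compact (f @` `[0, 1]).
  apply: continuous_compact; first exact: continuous_subspaceT.
  exact: segment_compact.
exists (C + 1) => x /andP[x0 x1]; apply: (bC (C + 1)) => /=; first by rewrite ltrDl.
by exists x => //=; rewrite in_itv/= !ltW.
Qed.

Let m01 : measurable (`]0, 1[ : set (measurableTypeR R)).
Proof. exact: measurable_itv. Qed.

Lemma continuous_integrable01 (f : R -> R) : continuous f ->
  leb.-integrable `]0, 1[ (EFin \o f).
Proof.
move=> cf; apply: measurable_bounded_integrable => //.
- suff : (@lebesgue_measure R `]0%R, 1%R[ < +oo)%E by [].
  by rewrite lebesgue_measure_itv/= lte_fin ltr01 -EFinB ltry.
- by apply: measurable_funTS; exact: continuous_measurable_fun.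
- have [C fC] := continuous_bounded01 cf; exists C; split; first exact: num_real.
  move=> c Cc x /=; rewrite in_itv/= => x01.
  by apply: (le_trans (fC x x01)); exact: ltW.
Qed.

Lemma ccontinuous1_cintegrable phi : ccontinuous1 phi -> cintegrable leb `]0, 1[ phi.
Proof. by move=> [c1 c2]; split; exact: continuous_integrable01. Qed.

Lemma ccontinuous1M phi psi : ccontinuous1 phi -> ccontinuous1 psi ->
  ccontinuous1 (fun x => phi x * psi x).
Proof.
move=> [v1 v2] [w1 w2]; split.
- under eq_fun do rewrite cReM.
  by move=> x; apply: cvgB; apply: cvgM; [exact: v1|exact: w1|exact: v2|exact: w2].
- under eq_fun do rewrite cImM.
  by move=> x; apply: cvgD; apply: cvgM; [exact: v1|exact: w2|exact: v2|exact: w1].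
Qed.

Lemma cderive1M phi psi : cderivable phi -> cderivable psi ->
  cderivable (fun x => phi x * psi x) /\
  cderive1 (fun x => phi x * psi x) =
    (fun x => cderive1 phi x * psi x + phi x * cderive1 psi x).
Proof.
move=> dv dw.
have ReE : (fun p => Re (phi p * psi p)) =
    (fun p => Re (phi p)) * (fun p => Re (psi p))
    - (fun p => Im (phi p)) * (fun p => Im (psi p)).
  by apply/funext => p; rewrite cReM.
have ImE : (fun p => Im (phi p * psi p)) =
    (fun p => Re (phi p)) * (fun p => Im (psi p))
    + (fun p => Im (phi p)) * (fun p => Re (psi p)).
  by apply/funext => p; rewrite cImM.
have D1 p := (dv p).1; have D2 p := (dv p).2.
have D3 p := (dw p).1; have D4 p := (dw p).2.
split => [p|].
  rewrite ReE ImE; split.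
  - by apply: derivableB; exact: derivableM.
  - by apply: derivableD; exact: derivableM.
apply/funext => p; rewrite {1}/cderive1 ReE ImE !derive1E.
rewrite deriveB; [|exact: derivableM|exact: derivableM].
rewrite deriveD; [|exact: derivableM|exact: derivableM].
rewrite !deriveM// -!derive1E.
apply: complex_eq; rewrite /= ?(cReD, cImD, cReM, cImM) /cderive1 /=.
- move: (derive1 _ _) (derive1 _ _) (derive1 _ _) (derive1 _ _) => ? ? ? ?.
  by rewrite /GRing.scale/=; ring.
- move: (derive1 _ _) (derive1 _ _) (derive1 _ _) (derive1 _ _) => ? ? ? ?.
  by rewrite /GRing.scale/=; ring.
Qed.

Lemma cderive1_conj phi : cderivable phi ->
  cderive1 (fun x => conjc (phi x)) = (fun x => conjc (cderive1 phi x)).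
Proof.
move=> dphi; apply/funext => x; rewrite /cderive1/=.
rewrite (_ : (fun y => Re (conjc (phi y))) = (fun y => Re (phi y))); last first.
  by apply/funext => y; rewrite Re_conjc.
rewrite (_ : (fun y => Im (conjc (phi y))) = - (fun y => Im (phi y))); last first.
  by apply/funext => y; rewrite Im_conjc.
rewrite !derive1E deriveN//; exact: (dphi x).2.
Qed.

Lemma smooth1_conj phi : smooth1 phi -> smooth1 (fun x => conjc (phi x)).
Proof.
move=> sphi n x; rewrite (_ : (fun y => Re (conjc (phi y))) = (fun y => Re (phi y))); last first.
  by apply/funext => y; rewrite Re_conjc.
rewrite (_ : (fun y => Im (conjc (phi y))) = - (fun y => Im (phi y))); last first.
  by apply/funext => y; rewrite Im_conjc.
rewrite (_ : derive1n n (- (fun y => Im (phi y))) =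
    - (derive1n n (fun y => Im (phi y)))).
  by split; [exact: (sphi n x).1|apply: derivableN; exact: (sphi n x).2].
elim: n => //= n ->; apply/funext => y.
by rewrite derive1E deriveN -?derive1E//; exact: (sphi n y).2.
Qed.

Lemma test1_conj phi : test1 phi -> test1 (fun x => conjc (phi x)).
Proof.
move=> [sphi [K [cK K01 phi0]]]; split; first exact: smooth1_conj.
by exists K; split => // x /phi0 ->; rewrite conjc0.
Qed.

Lemma cderive1_eq0_off phi (K : set R) : closed K -> (forall x, ~ K x -> phi x = 0) ->
  forall x, ~ K x -> cderive1 phi x = 0.
Proof.
move=> cK phi0 x Kx.
have near0 (f : R -> R) : (forall x, ~ K x -> f x = 0) -> derive1 f x = 0.
  move=> f0; rewrite derive1E -(@derive_cst R R R 0 x 1); apply: near_eq_derive.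
  have : \forall t \near x, ~ K t.
    by apply: open_nbhs_nbhs; split => //; exact: closed_openC.
  by apply: filterS => t /f0.
by rewrite /cderive1 !near0// => t /phi0 ->.
Qed.

Lemma test1_cderive1 phi : test1 phi -> test1 (cderive1 phi).
Proof.
move=> [sphi [K [cK K01 phi0]]]; split; first exact: smooth1_cderive1.
exists K; split => //; apply: cderive1_eq0_off => //.
by apply: compact_closed cK; exact: Rhausdorff.
Qed.

Lemma test1_ccontinuous phi : test1 phi -> ccontinuous1 phi.
Proof. by move=> [/smooth1_cderivable/cderivable_continuous]. Qed.

Lemma test1_cintegralM phi psi : test1 phi -> test1 psi ->
  cintegrable leb `]0, 1[ (fun x => phi x * psi x).
Proof.
move=> /test1_ccontinuous cphi /test1_ccontinuous cpsi.
by apply: ccontinuous1_cintegrable; exact: ccontinuous1M.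
Qed.

(** The derivative of the product vanishes off a compact subset of the interval,
    so that it may be integrated over the whole line. *)
Lemma test1_by_parts phi psi : test1 phi -> test1 psi ->
  distr1 (cderive1 phi) psi = ddx (distr1 phi) psi.
Proof.
move=> tphi tpsi; rewrite /ddx /distr1; apply/eqP; rewrite -addr_eq0; apply/eqP.
have [tphi' tpsi'] := (test1_cderive1 tphi, test1_cderive1 tpsi).
have [dphi dpsi] := (smooth1_cderivable tphi.1, smooth1_cderivable tpsi.1).
have [dM dME] := cderive1M dphi dpsi.
rewrite -cintegralD; [|exact: m01|exact: test1_cintegralM|exact: test1_cintegralM].
rewrite -dME.
have [K [cK K01 phi0]] := tphi.2.
have clK : closed K by apply: compact_closed cK; exact: Rhausdorff.
have cont : ccontinuous1 (cderive1 (fun x => phi x * psi x)).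
  rewrite dME; have [a1 a2] := ccontinuous1M (test1_ccontinuous tphi') (test1_ccontinuous tpsi).
  have [b1 b2] := ccontinuous1M (test1_ccontinuous tphi) (test1_ccontinuous tpsi').
  split.
  - by under eq_fun do rewrite cReD; move=> x; apply: cvgD; [exact: a1|exact: b1].
  - by under eq_fun do rewrite cImD; move=> x; apply: cvgD; [exact: a2|exact: b2].
have off x : ~ K x -> phi x * psi x = 0 by move=> /phi0 ->; rewrite mul0r.
have dz : forall x, ~ K x -> cderive1 (fun x => phi x * psi x) x = 0.
  exact: cderive1_eq0_off.
have part (F : R -> R) : (forall x, derivable F x 1) -> continuous (derive1 F) ->
    (forall x, ~ K x -> F x = 0) -> (forall x, ~ K x -> derive1 F x = 0) ->
    \int[leb]_(x in `]0, 1[) derive1 F x = 0.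
  move=> dF cF F0 F'0; rewrite Rintegral_mkcond /Rintegral.
  transitivity (fine (\int[leb]_x (derive1 F x)%:E)%E).
    congr fine; apply: eq_integral => x _; rewrite patchE; case: ifPn => // /negP x01.
    by rewrite F'0// => /K01 ?; apply: x01; rewrite inE.
  rewrite (@integral_derive1_eq0 _ F 1)// => x x1; apply: F0 => /K01/=.
  by rewrite in_itv/= => /andP[x0 x1']; move: x1; rewrite gtr0_norm// leNgt x1'.
apply: complex_eq => /=; apply: part.
- by move=> x; exact: (dM x).1.
- exact: cont.1.
- by move=> x /off ->.
- by move=> x Kx; have := dz x Kx => -[].
- by move=> x; exact: (dM x).2.
- exact: cont.2.
- by move=> x /off ->.
- by move=> x Kx; have := dz x Kx => -[].
Qed.

Lemma clocally_integrable_test1 phi : test1 phi -> clocally_integrable phi.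
Proof.
move=> /test1_ccontinuous[c1 c2].
have loc (f : R -> R) : continuous f -> locally_integrable `]0, 1[ f.
  move=> cf; split.
  - by apply: measurable_funTS; exact: continuous_measurable_fun.
  - exact: interval_open.
  - move=> K K01 cK.
    have := @continuous_compact_integrable _ f K cK (continuous_subspaceT cf).
    by move/integrableP => [_].
by split; exact: loc.
Qed.

End interval.

(** * Functions whose trace vanishes on Gamma_+ *)

Section zero_trace.
Context {R : realType}.
Local Notation plane := (measurableTypeR R * measurableTypeR R)%type.
Variable Omega : set (R * R).
Hypothesis GammaO : Gamma `<=` frontier Omega.

Let m01 : measurable (`]0, 1[ : set (measurableTypeR R)).
Proof. exact: measurable_itv. Qed.

(** A trace is only known to be measurable on [frontier Omega]; the segment lies
    in it, and is parametrized by a measurable map. *)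
Lemma cmeasurable_on_Gammap g : L2 len (frontier Omega) g ->
  cmeasurable (`]0, 1[ : set (measurableTypeR R)) (fun x => g (x, 0)).
Proof.
have incl : [set ((x, 0) : R * R) | x in `]0, 1[] `<=` frontier Omega.
  move=> _ [x /= + <-]; rewrite in_itv/= => /andP[x0 x1].
  apply: GammaO; split => //=; rewrite x1 andbT.
  by rewrite (lt_trans _ x0)// ltrN10.
have mi : measurable_fun (`]0, 1[ : set (measurableTypeR R))
    (fun x : measurableTypeR R => ((x, 0) : plane)).
  by apply: measurable_funTS; exact: pair2_measurable.
move=> /L2_cmeasurable[mr mi']; split.
- exact: (measurable_comp (measurable_frontier Omega) incl mr mi).
- exact: (measurable_comp (measurable_frontier Omega) incl mi' mi).
Qed.

(** The restriction of the trace to [Gamma_+] is almost everywhere zero, and so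
    is its distributional derivative: the zero function represents it and has a
    finite weighted norm whatever [alpha] is. *)
Lemma Valpha_zero_trace alpha v Gv g : H1 Omega v Gv -> is_trace Omega v Gv g ->
  {ae leb, forall x, 0 < x < 1 -> g (x, 0) = 0} ->
  Valpha Omega alpha v Gv (fun=> 0 : R[i]).
Proof.
move=> Hv tv g0; split => //; last first.
  rewrite (_ : (fun x => _) = fun=> 0); first exact: L2_zero.
  by apply/funext => x; rewrite mulr0.
split.
  have l0 : locally_integrable `]0, 1[ (fun=> 0 : R).
    split; [exact: measurable_cst|exact: interval_open|move=> K _ _].
    by rewrite integral0_eq ?ltry// => x _; rewrite normr0.
  by split.
exists g => // phi tphi; rewrite /ddx /distr1.
under eq_cintegral do rewrite mul0r.
rewrite cintegral0; apply/esym/eqP; rewrite oppr_eq0; apply/eqP.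
have mg := cmeasurable_on_Gammap tv.1.
have mdphi : cmeasurable (`]0, 1[ : set (measurableTypeR R)) (cderive1 phi).
  apply: cmeasurable_ccontinuous1 => //.
  by apply: test1_ccontinuous; exact: test1_cderive1.
have [mr mi] := cmeasurableM mg mdphi.
have ae0 (h : R -> R) : measurable_fun (`]0, 1[ : set (measurableTypeR R)) h ->
    (forall x, g (x, 0) = 0 -> h x = 0) -> \int[leb]_(x in `]0, 1[) h x = 0.
  move=> mh h0; rewrite /Rintegral (ae_eq_integral (cst 0%E))//.
  - by rewrite integral_cst// mul0e.
  - exact/measurable_EFinP.
  apply: (@filterS _ _ (ae_filter_ringOfSetsType leb)) g0 => x g0 /=.
  by rewrite in_itv/= => x01; rewrite h0// g0.
apply: complex_eq => /=; apply: ae0 => // x ->; rewrite mul0r//.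
Qed.

End zero_trace.

(** * The functional on traces defined by the Green formula *)

Section normal_flux.
Context {R : realType}.
Local Notation plane := (measurableTypeR R * measurableTypeR R)%type.
Variable Omega : set (R * R).
Hypotheses (openO : open Omega) (boundedO : bounded_set Omega).
Variables (Gu : 'I_2 -> R * R -> R[i]) (Lu : R * R -> R[i]).
Hypotheses (Gu2 : forall i, L2 area Omega (Gu i)) (Lu2 : L2 area Omega Lu).
Implicit Types (v w g h : R * R -> R[i]) (Gv Gw : 'I_2 -> R * R -> R[i]).

Let mO : measurable (Omega : set plane).
Proof. exact: measurable_domain. Qed.

(** The right-hand side of the Green formula, where [Lu] stands for the
    Laplacian of [u]. *)
Definition green v Gv : R[i] := cintegral area Omega (fun p =>
  \sum_(i < 2) Gu i p * conjc (Gv i p) + Lu p * conjc (v p)).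

Lemma cintegrable_green v Gv : H1 Omega v Gv ->
  cintegrable area Omega (fun p => \sum_(i < 2) Gu i p * conjc (Gv i p)) /\
  cintegrable area Omega (fun p => Lu p * conjc (v p)).
Proof.
move=> [v2 Gv2 _]; split; last by apply: (L2M mO) => //; exact: L2_conj.
under [X in cintegrable _ _ X]eq_fun do rewrite big_ord_recl big_ord1.
by apply: (cintegrableD mO); apply: (L2M mO) => //; exact: L2_conj.
Qed.

Lemma greenE v Gv : H1 Omega v Gv -> green v Gv =
  \sum_(i < 2) cintegral area Omega (fun p => Gu i p * conjc (Gv i p))
  + cintegral area Omega (fun p => Lu p * conjc (v p)).
Proof.
move=> Hv; have [iG iv] := cintegrable_green Hv; have [v2 Gv2 _] := Hv.
rewrite /green (cintegralD mO)//; congr (_ + _).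
rewrite big_ord_recl big_ord1 -(cintegralD mO).
- by apply: eq_cintegral => p _; rewrite big_ord_recl big_ord1.
- by apply: (L2M mO) => //; exact: L2_conj.
- by apply: (L2M mO) => //; exact: L2_conj.
Qed.

Lemma green_lincomb (a : R[i]) v Gv w Gw : H1 Omega v Gv -> H1 Omega w Gw ->
  green (fun p => a * v p + w p) (fun i p => a * Gv i p + Gw i p) =
  conjc a * green v Gv + green w Gw.
Proof.
move=> Hv Hw; have [iG iv] := cintegrable_green Hv; have [jG jw] := cintegrable_green Hw.
rewrite /green -(cintegral_lincomb mO); [|exact: (cintegrableD mO)|exact: (cintegrableD mO)].
apply: eq_cintegral => p _.
by rewrite !big_ord_recl !big_ord0 !rmorphD !rmorphM/=; ring.
Qed.

Lemma sqrt_sqnorm_le_H1 v Gv : H1 Omega v Gv ->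
  Num.sqrt (fine (sqnorm area Omega v)) <= Num.sqrt (fine (H1_sqnorm Omega v Gv)) /\
  forall i, Num.sqrt (fine (sqnorm area Omega (Gv i)))
    <= Num.sqrt (fine (H1_sqnorm Omega v Gv)).
Proof.
move=> [[_ _ v2] Gv2 _].
have s0 h := @sqnorm_ge0 _ plane R area Omega h.
have G2 i : (sqnorm area Omega (Gv i) < +oo)%E by have [] := Gv2 i.
have H0 : (0 <= H1_sqnorm Omega v Gv)%E by rewrite adde_ge0// sume_ge0.
have Hfin : H1_sqnorm Omega v Gv \is a fin_num.
  rewrite (ge0_fin_numE H0) /H1_sqnorm big_ord_recl big_ord1.
  by apply: lte_add_pinfty => //; exact: lte_add_pinfty.
have le h : (sqnorm area Omega h < +oo)%E ->
    (sqnorm area Omega h <= H1_sqnorm Omega v Gv)%E ->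
    Num.sqrt (fine (sqnorm area Omega h)) <= Num.sqrt (fine (H1_sqnorm Omega v Gv)).
  by move=> h2 hH; apply: ler_wsqrtr; apply: fine_le => //; rewrite (ge0_fin_numE (s0 h)).
split => [|i]; apply: le => //; rewrite /H1_sqnorm.
- by rewrite leeDl// sume_ge0.
- by rewrite (bigD1 i)//= addeCA leeDl// adde_ge0// sume_ge0.
Qed.

(** Each of the three pairings is bounded by the norm of one component of
    [(v, Gv)], hence by the norm of [v] in [H^1]. *)
Lemma green_bounded : exists2 K, 0 < K & forall v Gv, H1 Omega v Gv ->
  normc (green v Gv) <= K * Num.sqrt (fine (H1_sqnorm Omega v Gv)).
Proof.
pose k h : R := fine (sqnorm area Omega h) + 1.
have k0 h : 0 < k h by rewrite ltr_wpDl// fine_ge0// sqnorm_ge0.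
exists (\sum_(i < 2) k (Gu i) + k Lu).
  by rewrite big_ord_recl big_ord1; do 2!apply: addr_gt0 => //; exact: k0.
move=> v Gv Hv; have [v2 Gv2 _] := Hv; have [lev leG] := sqrt_sqnorm_le_H1 Hv.
have pair h w : L2 area Omega h -> L2 area Omega w ->
    Num.sqrt (fine (sqnorm area Omega w)) <= Num.sqrt (fine (H1_sqnorm Omega v Gv)) ->
    normc (cintegral area Omega (fun p => h p * conjc (w p))) <=
    k h * Num.sqrt (fine (H1_sqnorm Omega v Gv)).
  move=> h2 w2 lew; apply: (le_trans (L2_pairing_le mO h2 (L2_conj w2))).
  by rewrite sqnorm_conj ler_pM2l// k0.
rewrite (greenE Hv) !big_ord_recl !big_ord0 !addr0.
rewrite (mulrDl _ (k Lu)) (mulrDl (k _) (k (Gu _))).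
apply: (le_trans (le_normcD _ _)); apply: lerD; last exact: pair.
by apply: (le_trans (le_normcD _ _)); apply: lerD; exact: pair.
Qed.

(** The Green formula read as a definition on boundary values: [h] is turned
    into the conjugate of a trace, and any function with that trace may be
    inserted as soon as [green] vanishes on functions of trace zero. *)
Definition normal_flux h : R[i] :=
  if pselect (exists vG : (R * R -> R[i]) * ('I_2 -> R * R -> R[i]),
    H1 Omega vG.1 vG.2 /\ is_trace Omega vG.1 vG.2 (fun p => conjc (h p)))
  is left e then green (sval (cid e)).1 (sval (cid e)).2 else 0.

Hypothesis green0 : forall v Gv, H1 Omega v Gv ->
  is_trace Omega v Gv (fun=> 0) -> green v Gv = 0.

(** Two functions with trace [g] differ by a function of trace zero, where
    [green] vanishes. *)
Lemma normal_fluxE v Gv g : H1 Omega v Gv -> is_trace Omega v Gv g ->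
  normal_flux (fun p => conjc (g p)) = green v Gv.
Proof.
move=> Hv tv; rewrite /normal_flux.
have -> : (fun p => conjc (conjc (g p))) = g by apply/funext => p; rewrite conjcK.
case: pselect => [e|]; last by case; exists (v, Gv).
case: cid => -[w Gw] /= [Hw tw].
have := green0 (H1_lincomb openO boundedO (-1) Hv Hw).
rewrite green_lincomb//.
have tvw := is_trace_lincomb openO (-1) Hv Hw tv tw.
rewrite (_ : (fun p => -1 * g p + g p) = fun=> 0) in tvw; last first.
  by apply/funext => p; rewrite mulN1r addNr.
move=> /(_ tvw)/eqP; rewrite rmorphN1 mulN1r addrC subr_eq0 => /eqP ->//.
Qed.

Lemma normal_flux_conjE v Gv g : H1 Omega v Gv -> is_trace Omega v Gv g ->
  normal_flux g = green (fun p => conjc (v p)) (fun i p => conjc (Gv i p)).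
Proof.
move=> Hv tv; rewrite -(normal_fluxE (H1_conj openO boundedO Hv) (is_trace_conj tv)).
by congr normal_flux; apply/funext => p; rewrite conjcK.
Qed.

Lemma H1_sqnorm_conj v Gv :
  H1_sqnorm Omega (fun p => conjc (v p)) (fun i p => conjc (Gv i p)) =
  H1_sqnorm Omega v Gv.
Proof.
rewrite /H1_sqnorm sqnorm_conj; congr (_ + _)%E.
by apply: eq_bigr => i _; rewrite sqnorm_conj.
Qed.

(** The bound holds for every function with the given trace, so that it passes
    to the infimum that defines the norm of [H^{1/2}]. *)
Lemma Hm12_normal_flux : Hm12 Omega normal_flux.
Proof.
split=> [a g h [v [Gv [Hv tv]]] [w [Gw [Hw tw]]]|].
  rewrite (normal_flux_conjE Hv tv) (normal_flux_conjE Hw tw).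
  rewrite (normal_flux_conjE (H1_lincomb openO boundedO a Hv Hw)
    (is_trace_lincomb openO a Hv Hw tv tw)).
  rewrite -[in RHS](conjcK a) -green_lincomb; [|exact: H1_conj..].
  congr green; first by apply/funext => p; rewrite rmorphD rmorphM.
  by apply/funext => i; apply/funext => p; rewrite rmorphD rmorphM.
have [K K0 bK] := green_bounded.
exists K => g [v [Gv [Hv tv]]].
rewrite -ler_pdivrMl//; apply: lb_le_inf.
  by exists (Num.sqrt (fine (H1_sqnorm Omega v Gv))), v, Gv.
move=> _ [w [Gw [Hw tw ->]]]; rewrite ler_pdivrMl//.
rewrite (normal_flux_conjE Hw tw) -(H1_sqnorm_conj w).
exact/bK/H1_conj.
Qed.

End normal_flux.

(** * The boundary is flat near Gamma *)

Section flat_boundary.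
Context {R : realType}.
Variable Omega : set (R * R).
Hypotheses (openO : open Omega) (lipschitzO : lipschitz_boundary Omega)
  (GammaO : Gamma `<=` frontier Omega).

Lemma klipschitz_continuous (K : R) (gamma : R -> R) :
  K.-lipschitz gamma -> continuous gamma.
Proof.
move=> lip x.
have L y : `|gamma x - gamma y| <= K * `|x - y| by exact: (lip (x, y)).
apply/cvgrPdist_lt => e e0; near=> y.
apply: (le_lt_trans (L y)).
have K0 : 0 < `|K| + 1 by rewrite ltr_wpDl.
apply: (@le_lt_trans _ _ ((`|K| + 1) * `|x - y|)).
  by rewrite ler_wpM2r// (le_trans (ler_norm K))// lerDl.
rewrite mulrC -ltr_pdivlMr//; near: y.
have d0 : 0 < e / (`|K| + 1) by rewrite divr_gt0.
by have /cvgrPdist_lt := @cvg_id _ (nbhs x); exact.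
Unshelve. all: by end_near. Qed.

(** Strictly above the graph a point is in the open set [Omega], strictly below
    it is away from the closure of [Omega]. *)
Lemma frontier_graph (p : R * R) (r c s K : R) (gamma : R -> R) :
  K.-lipschitz gamma ->
  (forall q, ball p r q ->
     Omega q <-> gamma (c * q.1 + s * q.2) < - s * q.1 + c * q.2) ->
  forall q, ball p r q -> frontier Omega q ->
    gamma (c * q.1 + s * q.2) = - s * q.1 + c * q.2.
Proof.
move=> lip graph q pq [clq iq].
pose h (q : R * R) : R := gamma (c * q.1 + s * q.2) - (- s * q.1 + c * q.2).
have ch : continuous h.
  move=> x; apply: cvgB; last by apply: cvgD; apply: cvgMr; [exact: cvg_fst|exact: cvg_snd].
  apply: (@continuous_comp _ _ _ (fun q : R * R => c * q.1 + s * q.2) gamma).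
    by apply: cvgD; apply: cvgMr; [exact: cvg_fst|exact: cvg_snd].
  exact: (klipschitz_continuous lip).
have [hq|hq|/eqP] := ltgtP (h q) 0; last by rewrite subr_eq0 => /eqP.
- by exfalso; apply: iq; rewrite (interior_id Omega).1//; apply/graph => //; rewrite -subr_lt0.
- exfalso; have : nbhs q (fun q' => ball p r q' /\ 0 < h q').
    apply: filterI; last by have /cvgr_gt := ch q; exact.
    have [e /= e0 eb] : nbhs_ball q (ball p r).
      by rewrite nbhs_ballE; apply: open_nbhs_nbhs; split => //; exact: ball_open.
    by apply/nbhs_ballP; exists e.
  move/clq => [q' [Oq' [pq' h0]]].
  have hlt : h q' < 0 by rewrite /h subr_lt0; apply/graph.
  by have := lt_trans h0 hlt; rewrite ltxx.
Qed.

(** A Lipschitz graph that contains a segment of the axis coincides with that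
    segment near each interior point of it. *)
Lemma frontier_flat (p : R * R) : Gamma p ->
  exists2 d, 0 < d & forall q, ball p d q -> frontier Omega q -> q.2 = 0.
Proof.
case: p => p1 p2 [/= /andP[p1l p1r] ->] {p2}.
have [r [c [s [K [gamma [r0 cs1 lip graph]]]]]] :
  exists (r c s K : R) (gamma : R -> R),
    [/\ 0 < r, c ^+ 2 + s ^+ 2 = 1, K.-lipschitz gamma &
      forall q, ball (p1, 0) r q ->
        Omega q <-> gamma (c * q.1 + s * q.2) < - s * q.1 + c * q.2].
  by apply: lipschitzO; apply: GammaO; split => //=; rewrite p1l.
have fg := frontier_graph lip graph.
(* within [e] of the point, the segment stays in [Gamma] and in the chart *)
pose e := Num.min r (Num.min (p1 + 1) (1 - p1)).
have e0 : 0 < e by rewrite !lt_min r0 /=; lra.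
have er : e <= r by rewrite ge_min lexx.
have seg t : `|t| < e -> gamma (c * (p1 + t)) = - s * (p1 + t).
  rewrite !lt_min => /and3P[tr tl1 tl2].
  have := fg (p1 + t, 0); rewrite /= !mulr0 !addr0; apply.
    split => /=; rewrite /ball/=; last by rewrite subrr normr0.
    by rewrite opprD addrA subrr add0r normrN.
  apply: GammaO; split => //=.
  by move: tl1 tl2; rewrite !ltr_norml; lra.
(* otherwise the axis is vertical in the chart, and no graph contains it *)
have c_neq0 : c != 0.
  apply/eqP => c0.
  have := seg 0; have := seg (e / 2); rewrite c0 !mul0r normr0 => /(_ _) h1 /(_ e0) h2.
  have {}h1 : gamma 0 = - s * (p1 + e / 2).
    by apply: h1; rewrite gtr0_norm ?divr_gt0// ltr_pdivrMr// ltr_pMr// ltr1n.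
  have s0 : s * e = 0 by move: h2; rewrite h1 addr0; lra.
  move/eqP: s0; rewrite mulf_eq0 (gt_eqF e0) orbF => /eqP s0.
  by move: cs1; rewrite c0 s0 expr0n/= addr0 => /eqP; rewrite eq_sym oner_eq0.
(* [k] bounds the ratio of the displacement [t] below to the distance to [p] *)
pose k := 1 + `|s / c|.
have k1 : 1 <= k by rewrite lerDl.
have k0 : 0 < k by rewrite (lt_le_trans ltr01).
exists (e / k); first by rewrite divr_gt0.
move=> [q1 q2] pq fq /=.
have dr : e / k <= r by rewrite (le_trans _ er)// ler_pdivrMr// ler_peMr// ltW.
have := fg _ (le_ball dr pq) fq => /=.
case: pq; rewrite /ball/= sub0r normrN => d1 d2.
(* [(p1 + t, 0)] is the point of the axis with the same abscissa in the chart as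
   [(q1, q2)] *)
pose t := q1 + s / c * q2 - p1.
have te : `|t| < e.
  rewrite (_ : t = - (p1 - q1) + s / c * q2); last by rewrite /t; ring.
  rewrite (le_lt_trans (ler_normD _ _))// normrN normrM.
  rewrite (_ : e = e / k + `|s / c| * (e / k)); last by rewrite /k; field; rewrite gt_eqF.
  by rewrite ltr_leD// ler_wpM2l// ltW.
have := seg _ te.
have -> : c * (p1 + t) = c * q1 + s * q2 by rewrite /t; field.
move=> -> /(congr1 (fun x => x * c)).
have -> : - s * (p1 + t) * c = - s * c * q1 - s ^+ 2 * q2 by rewrite /t; field.
move=> h; have : (c ^+ 2 + s ^+ 2) * q2 = 0.
  by move: h; rewrite !expr2; lra.
by rewrite cs1 mul1r.
Qed.

(** Compactness of [K] turns the radii of [frontier_flat] into one width. *)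
Lemma frontier_flat_compact (K : set R) : compact K -> K `<=` `]0, 1[ ->
  exists2 d, 0 < d & forall x y, K x -> `|y| < d -> frontier Omega (x, y) -> y = 0.
Proof.
move=> /compact_near_coveringP cK K01.
have : \forall d \near 0^'+, K `<=` (fun d x => forall y, `|y| < d ->
    frontier Omega (x, y) -> y = 0) d.
  apply: cK => x /K01/=; rewrite in_itv/= => /andP[x0 x1].
  have [d d0 flat] : exists2 d, 0 < d &
      forall q, ball (x, 0) d q -> frontier Omega q -> q.2 = 0.
    by apply: frontier_flat; split => //=; rewrite x1 andbT (lt_trans _ x0)// ltrN10.
  exists (ball x d, [set e | e < d]).
    by split; [exact: nbhsx_ballx|exact: nbhs_right_lt].
  move=> [x' e] [/= xx' ed] y ye fy.
  apply: (flat (x', y)) => //; split => //=.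
  by rewrite /ball/= sub0r normrN (lt_trans ye).
move=> near_d; have : \forall d \near 0^'+, 0 < d /\ K `<=` (fun d x => forall y, `|y| < d ->
    frontier Omega (x, y) -> y = 0) d.
  by apply: filterI near_d; exact: nbhs_right_gt.
by move/filter_ex => [d [d0 Kd]]; exists d => // x y Kx; exact: Kd.
Qed.

End flat_boundary.

(** * The length of Gamma_+ is finite *)

Section length_of_segment.
Context {R : realType}.
Local Notation plane := (measurableTypeR R * measurableTypeR R)%type.

Definition Gammap : set (R * R) := [set p | 0 < p.1 < 1 /\ p.2 = 0].

Lemma measurable_Gammap : measurable (Gammap : set plane).
Proof.
rewrite (_ : Gammap = `]0, 1[ `*` [set 0]).
  by apply: measurableX; [exact: measurable_itv|exact: measurable_set1].
by apply/seteqP; split => -[x y] []; rewrite /= in_itv.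
Qed.

(** The segment is covered by [n + 1] pieces of length [1 / (n + 1)], for [n]
    arbitrarily large; the total diameter of the pieces is [1]. *)
Lemma len_Gammap_lty : (len (Gammap : set plane) < +oo)%E.
Proof.
apply: (@le_lt_trans _ _ 1%E); last exact: ltry.
apply: ge_ereal_sup => _ /= [d d0 <-].
have [n nd] := @ltr_add_invr R 0 d d0; rewrite add0r in nd.
pose N : R := n.+1%:R.
have N0 : 0 < N by rewrite ltr0n.
pose F (i : nat) : set (R * R) := if (i < n.+1)%N then
  [set p | i%:R <= p.1 * N <= i.+1%:R /\ p.2 = 0] else set0.
have dF i : (diam (F i) <= (if (i < n.+1)%N then N^-1 else 0)%:E)%E.
  rewrite /F; case: ifPn => _; last by rewrite diam0.
  apply: ge_ereal_sup => _ [->|[p [q [[p1 p2] [q1 q2] ->]]]].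
    by rewrite lee_fin invr_ge0 ltW.
  rewrite lee_fin /dist2 p2 q2 subrr expr0n/= addr0 sqrtr_sqr.
  rewrite -[_^-1]mul1r ler_pdivlMr// -[X in _ * X](gtr0_norm N0) -normrM mulrBl.
  move: p1 q1 => /andP[a b] /andP[a' b']; rewrite ler_norml.
  by move: b b'; rewrite -addn1 natrD => b b'; apply/andP; split; lra.
apply: (@le_trans _ _ (\sum_(i <oo) diam (F i))%E).
  apply: ereal_inf_lbound; exists F => //; split => [p [/andP[p0 p1] p2]|i]; last first.
    apply: (le_trans (dF i)); case: ifP => _; first by rewrite lee_fin ltW.
    by rewrite lee_fin ltW.
  have pN : 0 <= p.1 * N by rewrite mulr_ge0// ltW.
  have /andP[t1 t2] := truncn_itv pN.
  have tn : (Num.truncn (p.1 * N) < n.+1)%N.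
    rewrite -(ltr_nat R) (le_lt_trans t1)// -[ltRHS]mul1r ltr_pM2r//.
  exists (Num.truncn (p.1 * N)) => //; rewrite /F tn; split => //.
  by rewrite t1 ltW.
apply: lime_le; first by apply: is_cvg_nneseries => i _ _; exact: diam_ge0.
apply: nearW => m /=.
apply: (@le_trans _ _ (\sum_(0 <= i < m) (if (i < n.+1)%N then N^-1 else 0)%:E)%E).
  by apply: lee_sum => i _; exact: dF.
rewrite sumEFin lee_fin (_ : \sum_(0 <= i < m) _ = (minn m n.+1)%:R / N).
  by rewrite ler_pdivrMr// mul1r ler_nat geq_minr.
elim: m => [|m IH]; first by rewrite big_nil min0n mul0r.
rewrite big_nat_recr//= IH; have [mn|] := boolP (m < n.+1)%N; last rewrite -leqNgt => mn.
  by rewrite (minn_idPl mn) (minn_idPl (ltnW mn)) -addn1 natrD mulrDl mul1r.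
by rewrite addr0 (minn_idPr mn) (minn_idPr (leqW mn)).
Qed.

End length_of_segment.

(** * A cutoff function of class C^1 *)

Section cutoff.
Context {R : realType}.
Implicit Types (x y t d : R).

Definition sqpos t : R := Num.max 0 t ^+ 2.

(** [sqpos] is convex and its derivative is Lipschitz with constant [2], which
    gives the second order Taylor bound. *)
Let sqpos_taylor t h : `|sqpos (h + t) - sqpos t - 2 * Num.max 0 t * h| <= h ^+ 2.
Proof.
rewrite /sqpos !expr2 ler_norml; case: (leP 0 t); case: (leP 0 (h + t)) => H1 H2;
  apply/andP; split; nra.
Qed.

Let derive_sqpos t : derivable sqpos t 1 /\ derive1 sqpos t = 2 * Num.max 0 t.
Proof.
have lim : h^-1 *: ((sqpos \o shift t) (h *: 1) - sqpos t) @[h --> 0^'] -->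
    2 * Num.max 0 t.
  apply/cvgrPdist_le => e e0; near=> h.
  have h0 : h != 0 by near: h; exact: nbhs_dnbhs_neq.
  have he : `|h| <= e by near: h; exact: dnbhs0_le.
  rewrite /= /GRing.scale/= mulr1 -normrN opprB.
  have -> : h^-1 * (sqpos (h + t) - sqpos t) - 2 * Num.max 0 t =
      h^-1 * (sqpos (h + t) - sqpos t - 2 * Num.max 0 t * h) by field.
  rewrite normrM normfV ler_pdivrMl ?normr_gt0//.
  rewrite (le_trans (sqpos_taylor t h))// -(real_normK (num_real h)) expr2.
  by rewrite ler_wpM2l.
split; first by apply/cvg_ex; exists (2 * Num.max 0 t).
by rewrite derive1E; exact/cvg_lim.
Unshelve. all: by end_near. Qed.

(** The positive part has a corner at [|y| = d], which squaring smooths out. *)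
Definition cutoff d y : R := sqpos (1 - (y / d) ^+ 2).

Lemma cutoff0 d : cutoff d 0 = 1.
Proof. by rewrite /cutoff /sqpos mul0r expr0n/= subr0 max_r// expr1n. Qed.

Lemma cutoff_eq0 d y : 0 < d -> d <= `|y| -> cutoff d y = 0.
Proof.
move=> d0 dy; rewrite /cutoff /sqpos max_l ?expr0n// subr_le0.
rewrite -(real_normK (num_real _)) normrM normfV (gtr0_norm d0).
by rewrite exprn_ege1// ler_pdivlMr// mul1r.
Qed.

Let arg d y : R := 1 - (y / d) ^+ 2.

Let derive_arg d y : derivable (arg d) y 1 /\
  derive1 (arg d) y = - (2 * (y / d) / d).
Proof.
have H : is_derive y (1 : R) (arg d) (- (2 * (y / d) / d)).
  rewrite /arg; apply: is_derive_eq.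
  rewrite /GRing.scale/=; ring.
by split; [exact: ex_derive|rewrite derive1E; exact: derive_val].
Qed.

Let derive_cutoff d y : derivable (cutoff d) y 1 /\
  derive1 (cutoff d) y = 2 * Num.max 0 (arg d y) * (- (2 * (y / d) / d)).
Proof.
have [d1 e1] := derive_arg d y; have [d2 e2] := derive_sqpos (arg d y).
split.
  have : differentiable (sqpos \o arg d) y.
    by apply: differentiable_comp; exact/derivable1_diffP.
  by move/derivable1_diffP.
have -> : derive1 (cutoff d) y = derive1 (sqpos \o arg d) y by [].
by rewrite (derive1_comp d1 d2) e1 e2.
Qed.

Lemma derivable_cutoff d y : derivable (cutoff d) y 1.
Proof. exact: (derive_cutoff d y).1. Qed.

Lemma continuous_derive1_cutoff d : continuous (derive1 (cutoff d)).
Proof.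
rewrite (_ : derive1 _ = fun y => 2 * Num.max 0 (arg d y) * (- (2 * (y / d) / d))).
  have cl : continuous (fun y : R => y / d).
    by move=> y; apply: cvgMl; exact: cvg_id.
  move=> y; apply: cvgM.
    apply: cvgMr; apply: (@continuous_max R R (cst 0) (arg d) y); first exact: cvg_cst.
    by apply: differentiable_continuous; apply/derivable1_diffP; exact: (derive_arg d y).1.
  by apply: cvgN; apply: cvgMl; apply: cvgMr; exact: cl.
by apply/funext => y; exact: (derive_cutoff d y).2.
Qed.

End cutoff.

Section one_variable.
Context {R : realType}.
Implicit Types (phi : R -> R[i]).

(** The partial derivative along the other axis is zero, so that one derivative
    in one variable suffices. *)
Lemma C1_fst phi : cderivable phi -> ccontinuous1 (cderive1 phi) ->
  C1 (fun p => phi p.1).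
Proof.
move=> dphi [c1 c2].
have [k1 k2] := cderivable_continuous dphi.
have comp (F : R -> R) : continuous F -> continuous (fun p : R * R => F p.1).
  by move=> cF p; apply: (@continuous_comp _ _ _ fst F); [exact: cvg_fst|exact: cF].
have pd0 : pd ord0 (fun p => phi p.1) = fun p => cderive1 phi p.1.
  apply/funext => -[x y]; rewrite /pd.
  by rewrite (derive_slice_fst _ x y).2 (derive_slice_fst _ x y).2.
have pd1 : pd ord_max (fun p => phi p.1) = fun=> 0.
  apply/funext => -[x y]; rewrite /pd.
  by rewrite (derive_slice_snd _ x y).2 (derive_slice_snd _ x y).2/= !derive1_cst.
split; first by split; [exact: (comp _ k1)|exact: (comp _ k2)].
move=> i; have [->|->] := ord2P i.
- split; last by rewrite pd0; split; [exact: (comp _ c1)|exact: (comp _ c2)].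
  move=> [x y]; have [d1 d2] := dphi x.
  by split; apply/(derive_slice_fst _ x y).1; [exact: d1|exact: d2].
- split; last by rewrite pd1; exact: ccontinuous0.
  move=> [x y]; split; apply/(derive_slice_snd _ x y).1.
    exact: (@derivable_cst R R R (Re (phi x)) y 1).
  exact: (@derivable_cst R R R (Im (phi x)) y 1).
Qed.

Lemma C1_snd phi : cderivable phi -> ccontinuous1 (cderive1 phi) ->
  C1 (fun p => phi p.2).
Proof.
move=> dphi [c1 c2].
have [k1 k2] := cderivable_continuous dphi.
have comp (F : R -> R) : continuous F -> continuous (fun p : R * R => F p.2).
  by move=> cF p; apply: (@continuous_comp _ _ _ snd F); [exact: cvg_snd|exact: cF].
have pd0 : pd ord_max (fun p => phi p.2) = fun p => cderive1 phi p.2.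
  apply/funext => -[x y]; rewrite /pd.
  by rewrite (derive_slice_snd _ x y).2 (derive_slice_snd _ x y).2.
have pd1 : pd ord0 (fun p => phi p.2) = fun=> 0.
  apply/funext => -[x y]; rewrite /pd.
  by rewrite (derive_slice_fst _ x y).2 (derive_slice_fst _ x y).2/= !derive1_cst.
split; first by split; [exact: (comp _ k1)|exact: (comp _ k2)].
move=> i; have [->|->] := ord2P i.
- split; last by rewrite pd1; exact: ccontinuous0.
  move=> [x y]; split; apply/(derive_slice_fst _ x y).1.
    exact: (@derivable_cst R R R (Re (phi y)) x 1).
  exact: (@derivable_cst R R R (Im (phi y)) x 1).
- split; last by rewrite pd0; split; [exact: (comp _ c1)|exact: (comp _ c2)].
  move=> [x y]; have [d1 d2] := dphi y.
  by split; apply/(derive_slice_snd _ x y).1; [exact: d1|exact: d2].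
Qed.

End one_variable.

(** * Extending test functions of Gamma_+ into the domain *)

Section extension.
Context {R : realType}.
Local Notation plane := (measurableTypeR R * measurableTypeR R)%type.
Variable Omega : set (R * R).
Hypotheses (openO : open Omega) (boundedO : bounded_set Omega)
  (lipschitzO : lipschitz_boundary Omega) (GammaO : Gamma `<=` frontier Omega).
Implicit Types (phi : R -> R[i]) (w : R * R -> R[i]).

Let m01 : measurable (`]0, 1[ : set (measurableTypeR R)).
Proof. exact: measurable_itv. Qed.

(** The function is [phi x * cutoff d y], where [d] is a width for which the
    boundary lies on the axis above the support of [phi]: off the axis, one of
    the two factors vanishes at each boundary point. *)
Lemma C1_extension phi : test1 phi -> exists2 w, C1 w &
  forall p, frontier Omega p -> w p = zero_ext phi p.
Proof.
move=> tphi; have [_ [K [cK K01 phi0]]] := tphi.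
have [d d0 flat] := frontier_flat_compact openO lipschitzO GammaO cK K01.
exists (fun p => phi p.1 * (cutoff d p.2)%:C%C).
  apply: C1M.
    apply: C1_fst; first exact: smooth1_cderivable tphi.1.
    by apply: test1_ccontinuous; exact: test1_cderive1.
  apply: (@C1_snd _ (fun y => (cutoff d y)%:C%C)).
    by move=> y; split; [exact: derivable_cutoff|exact: (@derivable_cst R R R 0 y 1)].
  split; first exact: continuous_derive1_cutoff.
  rewrite (_ : (fun y => _) = cst 0); first by move=> y; exact: cvg_cst.
  by apply/funext => y; rewrite /cderive1 /= derive1_cst.
move=> [x y] fxy; rewrite /zero_ext /=.
have [Kx|nKx] := pselect (K x); last first.
  by rewrite phi0// mul0r; case: ifP.
have /= := K01 _ Kx; rewrite in_itv/= => ->; rewrite andbT.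
case: eqVneq => [->|y0]; first by rewrite cutoff0 mulr1.
rewrite cutoff_eq0 ?mulr0// leNgt; apply/negP => yd.
by move/eqP: y0; apply; exact: flat fxy.
Qed.

(** Measurability is inherited from [w], and finiteness from the boundedness of
    [phi] and the finite length of [Gamma_+]. *)
Lemma L2_zero_ext phi w : test1 phi -> C1 w ->
  (forall p, frontier Omega p -> w p = zero_ext phi p) ->
  L2 len (frontier Omega) (zero_ext phi).
Proof.
move=> tphi cw wphi.
have mF := measurable_frontier Omega.
have mz : cmeasurable (frontier Omega : set plane) (zero_ext phi : plane -> R[i]).
  have [m1 m2] := cmeasurable_ccontinuous mF cw.1.
  by split; [apply: eq_measurable_fun m1|apply: eq_measurable_fun m2] => p;
    rewrite inE => /wphi ->.
have [c1 c2] := test1_ccontinuous tphi.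
have [C1 b1] := continuous_bounded01 c1; have [C2 b2] := continuous_bounded01 c2.
have C0 : 0 <= C1 ^+ 2 + C2 ^+ 2 by rewrite addr_ge0// sqr_ge0.
apply/L2P; split => //.
apply: (@le_lt_trans _ _ (\int[len]_(p in frontier Omega)
    ((C1 ^+ 2 + C2 ^+ 2)%:E * (\1_(Gammap : set plane) p)%:E))%E).
  apply: ge0_le_integral => //.
  - by move=> p _; rewrite lee_fin sqr_ge0.
  - exact: measurable_sqr_normcE.
  - apply: emeasurable_funM; first exact: measurable_cst.
    by apply/measurable_EFinP; apply: measurable_indic; exact: measurable_Gammap.
  - move=> [x y] _; rewrite -EFinM lee_fin /zero_ext /= indicE.
    case: ifPn => [/andP[/eqP y0 x01]|_]; last first.
      by rewrite sqr_normcE/= expr0n/= addr0 mulr_ge0.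
    rewrite mem_set ?mulr1; last by [].
    rewrite sqr_normcE -(real_normK (num_real (Re _))) -(real_normK (num_real (Im _))).
    have [e1 e2] := (b1 x x01, b2 x x01).
    have [n1 n2] := (le_trans (normr_ge0 _) e1, le_trans (normr_ge0 _) e2).
    by apply: lerD; rewrite lerXn2r.
have m1 : measurable_fun (frontier Omega : set plane)
    (fun p => (\1_(Gammap : set plane) p : R)%:E).
  by apply/measurable_EFinP; apply: measurable_indic; exact: measurable_Gammap.
rewrite ge0_integralZl//.
rewrite integral_indic//; last exact: measurable_Gammap.
apply: lte_mul_pinfty => //.
apply: le_lt_trans len_Gammap_lty; apply: le_measure; rewrite ?inE//.
- by apply: measurableI => //; exact: measurable_Gammap.
- exact: measurable_Gammap.
Qed.

Lemma trace_extension phi w : test1 phi -> C1 w ->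
  (forall p, frontier Omega p -> w p = zero_ext phi p) ->
  is_trace Omega w (fun i => pd i w) (zero_ext phi).
Proof. by move=> tphi cw wphi; apply: is_trace_C1 => //; exact: L2_zero_ext wphi. Qed.

Lemma H12_zero_ext phi : test1 phi -> H12 Omega (zero_ext phi).
Proof.
move=> tphi; have [w cw wphi] := C1_extension tphi.
by exists w, (fun i => pd i w); split; [exact: H1_C1|exact: trace_extension].
Qed.

(** The weight is at most [1] on the unit interval. *)
Lemma L2_weighted_test1 (a : R) phi : 0 <= a -> test1 phi ->
  L2 leb `]0, 1[ (fun x => (x `^ a)%:C%C * phi x).
Proof.
move=> a0 tphi.
have mphi := cmeasurable_ccontinuous1 m01 (test1_ccontinuous tphi).
have phi2 : L2 leb `]0, 1[ phi.
  apply: cintegrable_L2 => //.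
  by apply: test1_cintegralM => //; exact: test1_conj.
have mp : cmeasurable (`]0, 1[ : set (measurableTypeR R)) (fun x => (x `^ a)%:C%C).
  by split; [apply: measurable_funTS; exact: measurable_powR|exact: measurable_cst].
have mpp := cmeasurableM mp mphi.
apply/L2P; split => //; have /L2P[_] := phi2; apply: le_lt_trans.
apply: ge0_le_integral => //.
- by move=> x _; rewrite lee_fin sqr_ge0.
- exact: measurable_sqr_normcE.
- exact: measurable_sqr_normcE.
move=> x /=; rewrite in_itv/= => /andP[x0 x1]; rewrite lee_fin.
rewrite ComplexField.Normc.normcM exprMn ler_piMl ?sqr_ge0//.
rewrite sqr_normcE/= expr0n/= addr0 exprn_ile1 ?powR_ge0//.
by rewrite -(powRr0 x) ger_powR// x0 ltW.
Qed.

Lemma Valpha_extension alpha phi w : 0 <= alpha -> test1 phi -> C1 w ->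
  (forall p, frontier Omega p -> w p = zero_ext phi p) ->
  Valpha Omega alpha w (fun i => pd i w) (cderive1 phi).
Proof.
move=> alpha0 tphi cw wphi; have tdphi := test1_cderive1 tphi.
split; first exact: H1_C1; last first.
  by apply: L2_weighted_test1 => //; rewrite divr_ge0.
split; first exact: clocally_integrable_test1.
exists (zero_ext phi); first exact: trace_extension.
move=> psi tpsi; rewrite (test1_by_parts tphi tpsi) /ddx; congr (- _).
apply: eq_cintegral => x /=; rewrite in_itv/= => x01.
by rewrite /zero_ext/= eqxx x01.
Qed.

End extension.

(** * From the variational identity to the boundary value problem *)

Section test_functions_in_Valpha.
Context {R : realType}.
Variable Omega : set (R * R).
Hypotheses (openO : open Omega) (boundedO : bounded_set Omega)
  (GammaO : Gamma `<=` frontier Omega).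

(** Test functions have trace zero because the open set [Omega] does not meet
    its frontier. *)
Lemma Valpha_test alpha phi : test Omega phi ->
  Valpha Omega alpha phi (fun i => pd i phi) (fun=> 0).
Proof.
move=> tphi; have cphi := test_C1 tphi.
apply: (@Valpha_zero_trace _ _ GammaO _ _ _ (fun=> 0)); first exact: H1_C1.
  apply: is_trace_C1 => //; first exact: L2_zero.
  have [_ [K [_ KO phi0]]] := tphi.
  move=> p [_]; rewrite (interior_id Omega).1// => pO.
  by apply: phi0 => /KO.
by apply: aeW.
Qed.

Lemma laplace_H1 u Gu phi : H1 Omega u Gu -> test Omega phi ->
  dlaplace (distr Omega u) phi = - \sum_(i < 2) distr Omega (Gu i) (pd i phi).
Proof.
move=> [_ _ du] tphi; rewrite /dlaplace -sumrN; apply: eq_bigr => i _.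
by rewrite {1}/dpd du//; exact: test_pd.
Qed.

Lemma green_conj_C1 Gu Lu w : (forall i, L2 area Omega (Gu i)) ->
  L2 area Omega Lu -> C1 w ->
  green Omega Gu Lu (fun p => conjc (w p)) (fun i => pd i (fun p => conjc (w p)))
  = \sum_(i < 2) distr Omega (Gu i) (pd i w) + distr Omega Lu w.
Proof.
move=> Gu2 Lu2 cw.
rewrite (greenE openO Gu2 Lu2 (H1_C1 openO boundedO (C1_conj cw))).
set A := (X in X + _ = _); set B := (X in _ + X = _).
have -> : B = distr Omega Lu w.
  by rewrite /B /distr; apply: eq_cintegral => p _; rewrite conjcK.
have -> // : A = \sum_(i < 2) distr Omega (Gu i) (pd i w).
rewrite /A; apply: eq_bigr => i _; rewrite /distr; apply: eq_cintegral => p _.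
by rewrite (pd_conj (pderivable_C1 i cw)).2 conjcK.
Qed.

End test_functions_in_Valpha.

Theorem theorem2p3 (R : realType) (Omega : set (R * R))
  (openO : open Omega) (connectedO : connected Omega)
  (boundedO : bounded_set Omega) (lipschitzO : lipschitz_boundary Omega)
  (GammaO : Gamma `<=` frontier Omega)
  (s : R) (hs : s = 1 \/ s = -1) (alpha : R) (halpha : 0 <= alpha)
  (f : R * R -> R[i]) (hf : L2 area Omega f)
  (u : R * R -> R[i]) (Gu : 'I_2 -> R * R -> R[i]) (du : R -> R[i])
  (hu : Valpha Omega alpha u Gu du)
  (hvar : forall (v : R * R -> R[i]) (Gv : 'I_2 -> R * R -> R[i])
    (dv : R -> R[i]), Valpha Omega alpha v Gv dv ->
    cintegral area Omega (fun p =>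
      \sum_(i < 2) Gu i p * conjc (Gv i p) + u p * conjc (v p))
    + s%:C%C * cintegral leb `]0, 1[
        (fun x => (x `^ alpha)%:C%C * du x * conjc (dv x))
    = cintegral area Omega (fun p => f p * conjc (v p))) :
  (forall phi, test Omega phi ->
     - dlaplace (distr Omega u) phi + distr Omega u phi = distr Omega f phi)
  /\ exists ell : (R * R -> R[i]) -> R[i],
    [/\ is_normal_derivative Omega u Gu ell,
        zero_off_Gammap Omega ell &
        eq_on_Gammap Omega ell (fun phi =>
          s%:C%C * ddx (distr1 (fun x => (x `^ alpha)%:C%C * du x)) phi)].
Proof.
have [Hu _ _] := hu; have [u2 Gu2 _] := Hu.
have mO := measurable_domain openO.
(* the Laplacian of [u], once the equation is known *)
pose Lu p := u p - f p.
have Lu2 : L2 area Omega Lu.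
  have := L2_lincomb mO (-1) hf u2.
  by under eq_fun do rewrite mulN1r addrC.
have LuE phi : C1 phi ->
    distr Omega Lu phi = distr Omega u phi - distr Omega f phi.
  move=> cphi; have phi2 := L2_ccontinuous mO boundedO cphi.1.
  rewrite -mulN1r addrC -(cintegral_lincomb mO); [|exact: L2M|exact: L2M].
  by apply: eq_cintegral => p _; rewrite /Lu; ring.
have greenV v Gv dv : Valpha Omega alpha v Gv dv -> green Omega Gu Lu v Gv =
    - (s%:C%C * cintegral leb `]0, 1[
        (fun x => (x `^ alpha)%:C%C * du x * conjc (dv x))).
  move=> Vv; have [Hv _ _] := Vv; have [v2 _ _] := Hv.
  have cv2 := L2_conj v2.
  have [iG _] := cintegrable_green openO Gu2 u2 Hv.
  apply/eqP; rewrite -addr_eq0; apply/eqP.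
  have -> : green Omega Gu Lu v Gv = cintegral area Omega (fun p =>
      \sum_(i < 2) Gu i p * conjc (Gv i p) + u p * conjc (v p))
      - cintegral area Omega (fun p => f p * conjc (v p)).
    rewrite -mulN1r addrC -(cintegral_lincomb mO); last 2 first.
    - exact: L2M.
    - by apply: (cintegrableD mO) => //; exact: L2M.
    by apply: eq_cintegral => p _; rewrite /Lu; ring.
  by rewrite -(hvar _ _ _ Vv) opprD addrA subrr add0r addNr.
have green_zero v Gv g : H1 Omega v Gv -> is_trace Omega v Gv g ->
    {ae leb, forall x, 0 < x < 1 -> g (x, 0) = 0} -> green Omega Gu Lu v Gv = 0.
  move=> Hv tv g0; rewrite (greenV _ _ _ (Valpha_zero_trace GammaO alpha Hv tv g0)).
  under eq_cintegral do rewrite conjc0 mulr0.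
  by rewrite cintegral0 mulr0 oppr0.
have green0 v Gv : H1 Omega v Gv -> is_trace Omega v Gv (fun=> 0) ->
    green Omega Gu Lu v Gv = 0.
  by move=> Hv tv; apply: (green_zero _ _ _ Hv tv); exact: aeW.
have eqn phi : test Omega phi ->
    - dlaplace (distr Omega u) phi + distr Omega u phi = distr Omega f phi.
  move=> tphi; have cphi := test_C1 tphi.
  have tcphi := test_conj tphi; have Vphi := Valpha_test openO boundedO GammaO alpha tcphi.
  have phi2 := L2_ccontinuous mO boundedO cphi.1.
  have := greenV _ _ _ Vphi; under eq_cintegral do rewrite conjc0 mulr0.
  rewrite cintegral0 mulr0 oppr0 (green_conj_C1 openO boundedO Gu2 Lu2 cphi).
  rewrite (laplace_H1 Hu tphi) opprK.
  by rewrite (LuE _ cphi) => /eqP; rewrite addrA subr_eq0 => /eqP.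
split => //; exists (normal_flux Omega Gu Lu).
have fluxE := normal_fluxE openO boundedO Gu2 Lu2 green0.
split.
- split; first exact: Hm12_normal_flux.
  exists Lu; split => // phi tphi.
  by rewrite (LuE _ (test_C1 tphi)) -(eqn _ tphi) opprD opprK addrCA subrr addr0.
- move=> g [v [Gv [Hv tv]]] g0.
  by rewrite (fluxE _ _ _ Hv tv); exact: green_zero g0.
move=> phi tphi; split; first exact: H12_zero_ext.
(* the functional is evaluated at the conjugate of a trace, so that the function
   to extend is the conjugate of [phi] *)
have tcphi := test1_conj tphi.
have [w cw wphi] := C1_extension openO lipschitzO GammaO tcphi.
have Vw := Valpha_extension openO boundedO halpha tcphi cw wphi.
have -> : zero_ext phi = fun p => conjc (zero_ext (fun x => conjc (phi x)) p).
  by apply/funext => p; rewrite /zero_ext; case: ifP; rewrite ?conjcK ?conjc0.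
rewrite (fluxE _ _ _ (H1_C1 openO boundedO cw) (trace_extension tcphi cw wphi)).
rewrite (greenV _ _ _ Vw) /ddx mulrN; set A := (X in - (_ * X) = _).
have -> // : A = distr1 (fun x => (x `^ alpha)%:C%C * du x) (cderive1 phi).
rewrite /A /distr1; apply: eq_cintegral => x _.
by rewrite (cderive1_conj (smooth1_cderivable tphi.1)) conjcK.
Qed.
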